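(* Let $q\in\mathbb{R}$ with $|q|>1$ and $n\ge0$. Let $\mathcal H$ be the Hilbert space with orthonormal basis $\{|k_0,k_1,\dots,k_n\rangle: k_0\in\mathbb{Z},\ k_1,\dots,k_n\in\mathbb{Z}_{\ge0}\}$ and let $\psi$ be the $*$-representation of $A(S^{2n+1}_q)$ on $\mathcal H$ given by $$\psi(x_1)|k_0,\dots,k_n\rangle=q^{-(k_1+\dots+k_n)}|k_0+1,k_1,\dots,k_n\rangle,$$ $$\psi(x_i)|k_0,\dots,k_n\rangle=(1-q^{-2k_{i-1}})^{1/2}q^{-(k_i+\dots+k_n)}|k_0,\dots,k_{i-1}-1,\dots,k_n\rangle,\quad i=2,\dots,n+1,$$ with $\psi(x_i^* )=\psi(x_i)^*$. Let $F|k_0,\dots,k_n\rangle=\chi(k_0)|k_0,\dots,k_n\rangle$, where $\chi(m)=1$ for $m>0$ and $\chi(m)=-1$ for $m\le0$. Then $[F,\psi(a)]$ is compact for every $a\in\mathcal C(S^{2n+1}_q)$ (where $\psi$ also denotes the extension to $\mathcal C(S^{2n+1}_q)$), and $[F,\psi(a)]$ is trace class for every $a\in A(S^{2n+1}_q)$. That is, $(\mathcal H,F)$ with the representation $\psi$ is an odd $1$-summable Fredholm module.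
   Context: The $*$-algebra $A(S^{2n+1}_q)$ is the unital complex $*$-algebra generated by $x_i,x_i^*$ ($i=1,\dots,n+1$) with relations $$x_ix_j=q\,x_jx_i\ (i<j),\qquad x_i^*x_j=q\,x_jx_i^*\ (i\neq j),\qquad [x_i,x_i^*]=(1-q^{-2})s_{i-1},\qquad s_{n+1}=1,$$ where $s_0:=0$ and $s_i:=s_{i-1}+x_i^*x_i$. $\mathcal C(S^{2n+1}_q)$ is the $C^*$-algebra obtained by completing $A(S^{2n+1}_q)$ in the supremum of the operator norms over all its $*$-representations on a separable Hilbert space. Every $*$-representation of $A(S^{2n+1}_q)$ extends to it. An odd $1$-summable Fredholm module over a $*$-algebra $A$ is a $*$-representation $\psi$ of $A$ on a Hilbert space together with a self-adjoint operator $F$ with $F^2=1$ such that $[F,\psi(a)]$ is trace class for all $a\in A$. *)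

(* Defs.v *)
From HB Require Import structures.
From mathcomp Require Import all_boot all_order all_algebra.
From mathcomp Require Import sesquilinear generic_quotient complex.
From mathcomp Require Import all_classical all_reals all_analysis.

Set Implicit Arguments.
Unset Strict Implicit.
Unset Printing Implicit Defensive.

Import Order.TTheory GRing.Theory Num.Theory.
Import numFieldNormedType.Exports.

Local Open Scope classical_set_scope.
Local Open Scope complex_scope.
Local Open Scope quotient_scope.
Local Open Scope ring_scope.

Reserved Notation "a ⋅ b" (at level 40, left associativity).

(* Unital *-algebras.  MathComp's [algType] is not used because it excludes the
   zero algebra. *)
HB.mixin Record isStarAlgebra (K : numClosedFieldType) A
    of GRing.Lmodule K A := {
  aone : A;
  amul : A -> A -> A;
  star : A -> A;
  amulA : associative amul;
  amul1l : left_id aone amul;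
  amul1r : right_id aone amul;
  amulDl : left_distributive amul +%R;
  amulDr : right_distributive amul +%R;
  amulZl : forall (c : K) (a b : A), amul (c *: a) b = c *: amul a b;
  amulZr : forall (c : K) (a b : A), amul a (c *: b) = c *: amul a b;
  starK : involutive star;
  starD : {morph star : a b / a + b};
  starZ : forall (c : K) (a : A), star (c *: a) = Num.conj c *: star a;
  starM : forall a b : A, star (amul a b) = amul (star b) (star a)
}.

#[short(type="starAlgType")]
HB.structure Definition StarAlgebra (K : numClosedFieldType) :=
  {A of GRing.Lmodule K A & isStarAlgebra K A}.

Notation "a ⋅ b" := (amul a b) : ring_scope.

HB.mixin Record isCStarAlgebra (K : numClosedFieldType) A
    of CompleteNormedModule K A & StarAlgebra K A := {
  cstar_normM : forall a b : A, `|a ⋅ b| <= `|a| * `|b|;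
  cstar_identity : forall a : A, `|star a ⋅ a| = `|a| ^+ 2
}.

#[short(type="cstarAlgType")]
HB.structure Definition CStarAlgebra (K : numClosedFieldType) :=
  {A of CompleteNormedModule K A & StarAlgebra K A & isCStarAlgebra K A}.

(* The inner product is linear in its first argument. *)
HB.mixin Record isHilbert (K : numClosedFieldType) H
    of CompleteNormedModule K H := {
  dotp : {dot H for (@Num.conj K)};
  dotp_norm : forall x : H, dotp x x = `|x| ^+ 2
}.

#[short(type="hilbertType")]
HB.structure Definition Hilbert (K : numClosedFieldType) :=
  {H of CompleteNormedModule K H & isHilbert K H}.

Definition star_morphism (K : numClosedFieldType) (A B : starAlgType K)
    (f : A -> B) : Prop :=
  [/\ linear f, f aone = aone, {morph f : a b / a ⋅ b} & {morph f : a / star a}].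

Definition separable (T : topologicalType) : Prop :=
  exists D : set T, countable D /\ dense D.

Section Operators.
Variables (K : numClosedFieldType) (H : hilbertType K).
Implicit Types T P F : H -> H.

Definition bounded_operator T : Prop := linear T /\ continuous T.

Definition selfadjoint T : Prop := forall x y, dotp (T x) y = dotp x (T y).

(* As K is ordered like the complex numbers, [0 <= z] says that z is real and
   nonnegative. *)
Definition positive_operator P : Prop :=
  bounded_operator P /\ forall x, 0 <= dotp (P x) x.

(* P = |T|: P is positive and P^2 = T^* T *)
Definition absolute_value T P : Prop :=
  positive_operator P /\ forall x y, dotp (P (P x)) y = dotp (T x) (T y).

Definition compact_operator T : Prop :=
  bounded_operator T /\ precompact (T @` [set x | `|x| <= 1]).

Definition commutator F T : H -> H := fun x => F (T x) - T (F x).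

Definition orthonormal_basis (I : choiceType) (e : I -> H) : Prop :=
  (forall k l, dotp (e k) (e l) = (k == l)%:R) /\
  dense [set x | exists s : seq (K * I), x = \sum_(p <- s) p.1 *: e p.2].

Record star_representation (A : starAlgType K) (pi : A -> H -> H) : Prop := {
  rep_bounded : forall a, bounded_operator (pi a);
  rep_linear : forall c a b x, pi (c *: a + b) x = c *: pi a x + pi b x;
  rep1 : forall x, pi aone x = x;
  repM : forall a b x, pi (a ⋅ b) x = pi a (pi b x);
  rep_star : forall a x y, dotp (pi a x) y = dotp x (pi (star a) y)
}.

End Operators.

(* The norm of a space over R[i] takes values in R[i]; suprema and infinite sums
   are taken in R. *)
Definition operator_norm (R : realType) (H : hilbertType R[i]) (T : H -> H) : R :=
  sup [set r : R | exists2 x : H, `|x| <= 1 & `|T x| = r%:C].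

Definition trace_class (R : realType) (H : hilbertType R[i]) (T : H -> H) : Prop :=
  bounded_operator T /\
  exists2 P, absolute_value T P &
    forall (I : choiceType) (e : I -> H), orthonormal_basis e ->
      (\esum_(k in [set: I]) (complex.Re (dotp (P (e k)) (e k)))%:E < +oo)%E.

Record odd_1summable_fredholm_module (R : realType) (A : starAlgType R[i])
    (H : hilbertType R[i]) (psi : A -> H -> H) (F : H -> H) : Prop := {
  fredholm_rep : star_representation psi;
  fredholm_bounded : bounded_operator F;
  fredholm_selfadjoint : selfadjoint F;
  fredholm_square : forall x, F (F x) = x;
  fredholm_trace : forall a, trace_class (commutator F (psi a))
}.

(* The supremum is finite for the quantum sphere, whose generators satisfy
   \sum_j x_j^* x_j = 1 and hence are sent to contractions. *)
Definition universal_norm (R : realType) (A : starAlgType R[i]) (a : A) : R :=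
  sup [set r : R | exists (H : hilbertType R[i]) (pi : A -> H -> H),
         [/\ separable H, star_representation pi & r = operator_norm (pi a)]].

(* iota exhibits C as the (Hausdorff) completion of A for the universal norm;
   iota is not required to be injective. *)
Record universal_completion (R : realType) (A : starAlgType R[i])
    (C : cstarAlgType R[i]) (iota : A -> C) : Prop := {
  completion_morphism : star_morphism iota;
  completion_dense : dense (range iota);
  completion_norm : forall a, `|iota a| = (universal_norm a)%:C
}.

(* Psi is the extension by continuity of the representation psi of A to the
   completion C. *)
Record extends_to_completion (R : realType) (A : starAlgType R[i])
    (C : cstarAlgType R[i]) (iota : A -> C) (H : hilbertType R[i])
    (psi : A -> H -> H) (Psi : C -> H -> H) : Prop := {
  extension_rep : star_representation Psi;
  extension_contractive : forall c x, `|Psi c x| <= `|c| * `|x|;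
  extensionE : forall a x, Psi (iota a) x = psi a x
}.

(* The defining relations of the quantum sphere.  The generators are numbered
   from 0, so that the i-th one is x_{i+1}, and the sum in the third relation
   is s_i. *)
Record sphere_relations (R : realType) (q : R) (n : nat) (B : starAlgType R[i])
    (x : 'I_n.+1 -> B) : Prop := {
  sphere_comm : forall i j : 'I_n.+1, (i < j)%N ->
    x i ⋅ x j = q%:C *: (x j ⋅ x i);
  sphere_star_comm : forall i j : 'I_n.+1, i != j ->
    star (x i) ⋅ x j = q%:C *: (x j ⋅ star (x i));
  sphere_bracket : forall i : 'I_n.+1,
    x i ⋅ star (x i) - star (x i) ⋅ x i =
    (1 - q ^- 2)%:C *: \sum_(j < n.+1 | (j < i)%N) star (x j) ⋅ x j;
  sphere_sum : \sum_(j < n.+1) star (x j) ⋅ x j = aone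
}.

(* The *-algebra generated by x_0, ..., x_n with the relations above: formal
   *-algebra expressions in the generators, two of them being identified when
   they have the same value in every *-algebra at all elements that satisfy the
   relations. *)
Inductive star_expr (K : Type) (n : nat) : Type :=
| EGen of 'I_n.+1
| EOne
| EAdd of star_expr K n & star_expr K n
| EScale of K & star_expr K n
| EMul of star_expr K n & star_expr K n
| EStar of star_expr K n.
Arguments EOne {K n}.
Arguments EGen {K n}.

HB.instance Definition _ K n := gen_eqMixin (star_expr K n).
HB.instance Definition _ K n := gen_choiceMixin (star_expr K n).

Fixpoint star_eval (K : numClosedFieldType) (n : nat) (B : starAlgType K)
    (x : 'I_n.+1 -> B) (t : star_expr K n) : B :=
  match t with
  | EGen i => x i
  | EOne => aone
  | EAdd t u => star_eval x t + star_eval x u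
  | EScale c t => c *: star_eval x t
  | EMul t u => star_eval x t ⋅ star_eval x u
  | EStar t => star (star_eval x t)
  end.

Section QuantumSphere.
Variables (R : realType) (q : R) (n : nat).

Definition sphere_eq (t u : star_expr R[i] n) : bool :=
  `[< forall (B : starAlgType R[i]) (x : 'I_n.+1 -> B),
        sphere_relations q x -> star_eval x t = star_eval x u >].

Lemma sphere_eq_equiv : equiv_class_of sphere_eq.
Proof.
split=> [t|t u|u t v].
- by apply/asboolP.
- by apply/asboolP/asboolP => h B x hx; rewrite h.
- by move=> /asboolP h1 /asboolP h2; apply/asboolP => B x hx; rewrite h1 // h2.
Qed.

Canonical sphere_equiv := EquivRelPack sphere_eq_equiv.

Definition qsphere : Type := {eq_quot sphere_equiv}.

HB.instance Definition _ := Choice.on qsphere.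

Definition qsphere_class (t : star_expr R[i] n) : qsphere :=
  \pi_({eq_quot sphere_equiv}) t.

Definition qsphere_gen (i : 'I_n.+1) : qsphere := qsphere_class (EGen i).

Definition qsphere_repr (a : qsphere) : star_expr R[i] n :=
  repr (a : {eq_quot sphere_equiv}).

Lemma qsphere_reprK a : qsphere_class (qsphere_repr a) = a.
Proof. exact: reprK. Qed.

Lemma qsphere_classP t u :
  (forall (B : starAlgType R[i]) (x : 'I_n.+1 -> B),
     sphere_relations q x -> star_eval x t = star_eval x u) <->
  qsphere_class t = qsphere_class u.
Proof.
split=> [h|/eqP]; first by apply/eqP; rewrite eqmodE; apply/asboolP.
by rewrite eqmodE => /asboolP.
Qed.

Definition qsphere_eval (B : starAlgType R[i]) (x : 'I_n.+1 -> B) (a : qsphere) :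
  B := star_eval x (qsphere_repr a).

Lemma qsphere_eval_class (B : starAlgType R[i]) (x : 'I_n.+1 -> B) t :
  sphere_relations q x -> qsphere_eval x (qsphere_class t) = star_eval x t.
Proof. by move=> hx; apply: (qsphere_classP _ _).2 => //; rewrite qsphere_reprK. Qed.

Lemma qsphereP (a b : qsphere) :
  (forall (B : starAlgType R[i]) (x : 'I_n.+1 -> B),
     sphere_relations q x -> qsphere_eval x a = qsphere_eval x b) -> a = b.
Proof.
by move=> h; rewrite -(qsphere_reprK a) -(qsphere_reprK b); apply/qsphere_classP.
Qed.

Definition qsphere_one : qsphere := qsphere_class EOne.
Definition qsphere_zero : qsphere := qsphere_class (EScale 0 EOne).
Definition qsphere_add (a b : qsphere) : qsphere :=
  qsphere_class (EAdd (qsphere_repr a) (qsphere_repr b)).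
Definition qsphere_scale (c : R[i]) (a : qsphere) : qsphere :=
  qsphere_class (EScale c (qsphere_repr a)).
Definition qsphere_opp (a : qsphere) : qsphere := qsphere_scale (-1) a.
Definition qsphere_mul (a b : qsphere) : qsphere :=
  qsphere_class (EMul (qsphere_repr a) (qsphere_repr b)).
Definition qsphere_star (a : qsphere) : qsphere :=
  qsphere_class (EStar (qsphere_repr a)).

Section Evaluation.
Variables (B : starAlgType R[i]) (x : 'I_n.+1 -> B).
Hypothesis hx : sphere_relations q x.

Lemma qsphere_eval1 : qsphere_eval x qsphere_one = aone.
Proof. exact: qsphere_eval_class. Qed.
Lemma qsphere_eval0 : qsphere_eval x qsphere_zero = 0.
Proof. by rewrite qsphere_eval_class //= scale0r. Qed.
Lemma qsphere_evalD a b :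
  qsphere_eval x (qsphere_add a b) = qsphere_eval x a + qsphere_eval x b.
Proof. exact: qsphere_eval_class. Qed.
Lemma qsphere_evalZ c a :
  qsphere_eval x (qsphere_scale c a) = c *: qsphere_eval x a.
Proof. exact: qsphere_eval_class. Qed.
Lemma qsphere_evalN a : qsphere_eval x (qsphere_opp a) = - qsphere_eval x a.
Proof. by rewrite qsphere_evalZ scaleN1r. Qed.
Lemma qsphere_evalM a b :
  qsphere_eval x (qsphere_mul a b) = qsphere_eval x a ⋅ qsphere_eval x b.
Proof. exact: qsphere_eval_class. Qed.
Lemma qsphere_eval_star a :
  qsphere_eval x (qsphere_star a) = star (qsphere_eval x a).
Proof. exact: qsphere_eval_class. Qed.

Definition qsphere_evalE := (qsphere_eval0, qsphere_eval1, qsphere_evalD,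
  qsphere_evalN, qsphere_evalZ, qsphere_evalM, qsphere_eval_star).

End Evaluation.

Local Ltac by_eval eqn :=
  repeat intro; apply: qsphereP;
  let B := fresh "B" in let y := fresh "y" in let hy := fresh "hy" in
  by intros B y hy; rewrite !(qsphere_evalE hy) eqn.

Lemma qsphere_addA : associative qsphere_add.
Proof. by_eval addrA. Qed.
Lemma qsphere_addC : commutative qsphere_add.
Proof. by move=> a b; apply: qsphereP => B x hx; rewrite !(qsphere_evalE hx) addrC. Qed.
Lemma qsphere_add0 : left_id qsphere_zero qsphere_add.
Proof. by_eval add0r. Qed.
Lemma qsphere_addN : left_inverse qsphere_zero qsphere_opp qsphere_add.
Proof. by_eval addNr. Qed.

HB.instance Definition _ := GRing.isZmodule.Build qsphere
  qsphere_addA qsphere_addC qsphere_add0 qsphere_addN.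

Lemma qsphere_scaleA c d a :
  qsphere_scale c (qsphere_scale d a) = qsphere_scale (c * d) a.
Proof. by_eval scalerA. Qed.
Lemma qsphere_scale1 : left_id 1 qsphere_scale.
Proof. by_eval scale1r. Qed.
Lemma qsphere_scaleDr : right_distributive qsphere_scale +%R.
Proof. by_eval scalerDr. Qed.
Lemma qsphere_scaleDl a : {morph qsphere_scale^~ a : c d / c + d}.
Proof. by_eval scalerDl. Qed.

HB.instance Definition _ := GRing.Zmodule_isLmodule.Build R[i] qsphere
  qsphere_scaleA qsphere_scale1 qsphere_scaleDr qsphere_scaleDl.

Lemma qsphere_mulA : associative qsphere_mul.
Proof. by_eval (@amulA R[i]). Qed.
Lemma qsphere_mul1l : left_id qsphere_one qsphere_mul.
Proof. by_eval (@amul1l R[i]). Qed.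
Lemma qsphere_mul1r : right_id qsphere_one qsphere_mul.
Proof. by_eval (@amul1r R[i]). Qed.
Lemma qsphere_mulDl : left_distributive qsphere_mul +%R.
Proof. by_eval (@amulDl R[i]). Qed.
Lemma qsphere_mulDr : right_distributive qsphere_mul +%R.
Proof. by_eval (@amulDr R[i]). Qed.
Lemma qsphere_mulZl (c : R[i]) (a b : qsphere) :
  qsphere_mul (c *: a) b = c *: qsphere_mul a b.
Proof. by_eval (@amulZl R[i]). Qed.
Lemma qsphere_mulZr (c : R[i]) (a b : qsphere) :
  qsphere_mul a (c *: b) = c *: qsphere_mul a b.
Proof. by_eval (@amulZr R[i]). Qed.
Lemma qsphere_starK : involutive qsphere_star.
Proof. by_eval (@starK R[i]). Qed.
Lemma qsphere_starD : {morph qsphere_star : a b / a + b}.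
Proof. by_eval (@starD R[i]). Qed.
Lemma qsphere_starZ (c : R[i]) (a : qsphere) :
  qsphere_star (c *: a) = Num.conj c *: qsphere_star a.
Proof. by_eval (@starZ R[i]). Qed.
Lemma qsphere_starM (a b : qsphere) :
  qsphere_star (qsphere_mul a b) = qsphere_mul (qsphere_star b) (qsphere_star a).
Proof. by_eval (@starM R[i]). Qed.

HB.instance Definition _ := isStarAlgebra.Build R[i] qsphere
  qsphere_mulA qsphere_mul1l qsphere_mul1r qsphere_mulDl qsphere_mulDr
  qsphere_mulZl qsphere_mulZr qsphere_starK qsphere_starD qsphere_starZ
  qsphere_starM.

Lemma qsphere_gen_relations : sphere_relations q qsphere_gen.
Proof.
have evP (B : starAlgType R[i]) (x : 'I_n.+1 -> B) (hx : sphere_relations q x) :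
  [/\ forall i, qsphere_eval x (qsphere_gen i) = x i,
      {morph qsphere_eval x : a b / a ⋅ b}, {morph qsphere_eval x : a / star a},
      forall a b, qsphere_eval x (a - b) = qsphere_eval x a - qsphere_eval x b &
      forall P : pred 'I_n.+1, qsphere_eval x
        (\sum_(j < n.+1 | P j) star (qsphere_gen j) ⋅ qsphere_gen j) =
        \sum_(j < n.+1 | P j) star (x j) ⋅ x j].
  have eg i : qsphere_eval x (qsphere_gen i) = x i by exact: qsphere_eval_class.
  split=> // [a b|a|a b|P]; first exact: qsphere_evalM.
  - exact: qsphere_eval_star.
  - by rewrite -(qsphere_evalN hx) -(qsphere_evalD hx).
  rewrite (big_morph (qsphere_eval x) (qsphere_evalD hx) (qsphere_eval0 hx)).
  by apply: eq_bigr => j _; rewrite (qsphere_evalM hx) (qsphere_eval_star hx) eg.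
split=> [i j ij|i j ij|i|]; apply: qsphereP => B x hx;
  have [eg eM es eB eS] := evP _ _ hx.
- by rewrite (qsphere_evalZ hx) !eM !eg; exact: sphere_comm hx _ _ ij.
- by rewrite (qsphere_evalZ hx) !eM !es !eg; exact: sphere_star_comm hx _ _ ij.
- rewrite (qsphere_evalZ hx) eB eS !eM !es !eg; exact: sphere_bracket hx i.
- rewrite eS (qsphere_eval1 hx); exact: sphere_sum hx.
Qed.

Lemma qsphere_eval_morphism (B : starAlgType R[i]) (x : 'I_n.+1 -> B) :
  sphere_relations q x ->
  star_morphism (qsphere_eval x) /\
  forall i, qsphere_eval x (qsphere_gen i) = x i.
Proof.
move=> hx; split; last by move=> i; exact: qsphere_eval_class.
split; [|exact: qsphere_eval1|exact: qsphere_evalM|exact: qsphere_eval_star].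
by move=> c a b; rewrite (qsphere_evalD hx) (qsphere_evalZ hx).
Qed.

End QuantumSphere.

Definition chi (R : realType) (m : int) : R[i] := if 0 < m then 1 else -1.

Definition decr (n : nat) (j : 'I_n) (k : {ffun 'I_n -> nat}) :
  {ffun 'I_n -> nat} := [ffun l => (k l - (l == j))%N].

(* Main.v *)
Require Import Defs.
From HB Require Import structures.
From mathcomp Require Import all_boot all_order all_algebra.
From mathcomp Require Import sesquilinear complex finmap.
From mathcomp Require Import all_classical all_reals all_analysis.
From mathcomp Require Import ring lra.

Set Implicit Arguments.
Unset Strict Implicit.
Unset Printing Implicit Defensive.

Import Order.TTheory GRing.Theory Num.Theory.
Import numFieldNormedType.Exports.

Local Open Scope classical_set_scope.
Local Open Scope complex_scope.
Local Open Scope ring_scope.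

(** F commutes with every x_i for i >= 2, and [F, x_1] maps |0, k> to
    2 q^-|k| |1, k> and kills the other basis vectors, so that the norms
    |[F, x_1] e_l| are summable by a product of geometric series.  The generators
    and their adjoints are weighted shifts of the basis, so right multiplication
    by them preserves the summability of |T e_l|; the Leibniz rule then gives
    sum_l |[F, a] e_l| < oo for every a in A(S).

    This summability in one orthonormal basis suffices for both claims.  If
    P = |T| and P = D^2 (up to a scalar), then in any other basis (f_k)
    sum_k <P f_k, f_k> = sum_k |D f_k|^2 <= sum_l |D e_l|^2 <= sum_l |P e_l|
    = sum_l |T e_l|.  It also makes T a norm limit of the finite-rank operators
    T P_s, P_s being the projection on finitely many basis vectors; compactness
    of [F, a] on the completion follows by taking norm limits once more. *)

(** * Inner products and bounded operators *)

(** Two square roots are taken because sums of squares are what survives a change of basis. The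
    first, P = |T|, is the witness that [trace_class] asks for. The second, D, turns <P x, x> into a
    multiple of |D x|^2, and Bessel's inequality compares such sums in two bases. Both come from the
    fixed point of Y = (B + Y^2) / 2, that is (1 - Y)^2 = 1 - B, which is reached by iteration from
    a self-adjoint contraction B, without spectral theory.

    The obstacle on the algebra side is that sum |T e_l| < oo is not stable under adjoints: for T =
    <., v> w with w nonzero it says that the coefficients of v are summable, and for T^* it concerns
    w instead. Each generator is therefore treated together with its adjoint, through the
    injectivity of the shift where its weight is nonzero.

    The extension to the completion has its own reason: sum x_j^* x_j = 1 bounds each element
    uniformly over all representations, so the universal norm is a genuine supremum, and the
    countable basis makes the space separable, so that [psi] takes part in it. *)

Section InnerProduct.
Variables (K : numClosedFieldType) (H : hilbertType K).
Implicit Types (x y z : H) (c : K).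

Lemma dotpDl x y z : dotp (x + y) z = dotp x z + dotp y z.
Proof. exact: linearDl. Qed.
Lemma dotpDr x y z : dotp x (y + z) = dotp x y + dotp x z.
Proof. exact: linearDr. Qed.
Lemma dotpZl c x y : dotp (c *: x) y = c * dotp x y.
Proof. exact: linearZl_LR. Qed.
Lemma dotpZr c x y : dotp x (c *: y) = c^* * dotp x y.
Proof. exact: linearZr. Qed.
Lemma dotpNl x y : dotp (- x) y = - dotp x y.
Proof. exact: linearNl. Qed.
Lemma dotpBl x y z : dotp (x - y) z = dotp x z - dotp y z.
Proof. exact: linearBl. Qed.
Lemma dotpBr x y z : dotp x (y - z) = dotp x y - dotp x z.
Proof. exact: linearBr. Qed.
Lemma dotp0l x : dotp 0 x = 0. Proof. exact: linear0l. Qed.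
Lemma dotp0r x : dotp x 0 = 0. Proof. exact: linear0r. Qed.
Lemma dotpC x y : dotp x y = (dotp y x)^*.
Proof. by rewrite hermC expr0 mul1r. Qed.

Lemma norm_sub_proj x y : `|y| = 1 ->
  `|x - dotp x y *: y| ^+ 2 = `|x| ^+ 2 - `|dotp x y| ^+ 2.
Proof.
move=> y1; rewrite -!dotp_norm dotpBl !dotpBr !dotpZl !dotpZr !dotp_norm.
by rewrite y1 expr1n mulr1 (dotpC y x) subrr subr0 normCKC.
Qed.

(** Cauchy-Schwarz: for the unit vector u along y, |x|^2 - |<x, u>|^2 is the square |x - <x, u>
    u|^2. *)
Lemma dotp_le x y : `|dotp x y| <= `|x| * `|y|.
Proof.
have [->|y0] := eqVneq y 0; first by rewrite dotp0r !normr0 mulr0.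
have ny : 0 < `|y| by rewrite normr_gt0.
set u := `|y|^-1 *: y.
have u1 : `|u| = 1 by rewrite normrZ normfV normr_id mulVf // gt_eqF.
have -> : y = `|y| *: u by rewrite scalerA mulfV ?gt_eqF // scale1r.
rewrite dotpZr normrM norm_conjC normr_id normrZ normr_id u1 mulr1 mulrC.
rewrite ler_pM2r // -(@ler_pXn2r _ 2%N) ?nnegrE //.
by rewrite -subr_ge0 -norm_sub_proj // exprn_ge0.
Qed.

Lemma dotp_suml (I : Type) (s : seq I) (f : I -> H) y :
  dotp (\sum_(i <- s) f i) y = \sum_(i <- s) dotp (f i) y.
Proof. exact: (big_morph (dotp^~ y) (fun u v => dotpDl u v y) (dotp0l y)). Qed.
Lemma dotp_sumr (I : Type) (s : seq I) (f : I -> H) x :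
  dotp x (\sum_(i <- s) f i) = \sum_(i <- s) dotp x (f i).
Proof. exact: (big_morph (dotp x) (dotpDr x) (dotp0r x)). Qed.

Lemma dotp_eq x y : (forall z, dotp x z = dotp y z) -> x = y.
Proof.
move=> h; apply/eqP; rewrite -subr_eq0 -normr_eq0 -sqrf_eq0 -dotp_norm.
by rewrite dotpBl h subrr.
Qed.

Lemma linear_op0 (T : H -> H) : linear T -> T 0 = 0.
Proof. by move=> h; have := h (-1) 0 0; rewrite !scaleN1r !addNr. Qed.
Lemma linear_opD (T : H -> H) x y : linear T -> T (x + y) = T x + T y.
Proof. by move=> h; have := h 1 x y; rewrite !scale1r. Qed.
Lemma linear_opZ (T : H -> H) c x : linear T -> T (c *: x) = c *: T x.
Proof. by move=> h; have := h c x 0; rewrite (linear_op0 h) !addr0. Qed.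
Lemma linear_opN (T : H -> H) x : linear T -> T (- x) = - T x.
Proof. by move=> h; rewrite -scaleN1r linear_opZ // scaleN1r. Qed.
Lemma linear_opB (T : H -> H) x y : linear T -> T (x - y) = T x - T y.
Proof. by move=> h; rewrite linear_opD // linear_opN. Qed.
Lemma linear_op_sum (T : H -> H) (I : Type) (s : seq I) (f : I -> H) :
  linear T -> T (\sum_(i <- s) f i) = \sum_(i <- s) T (f i).
Proof.
by move=> h; apply: big_morph; [move=> x y; exact: linear_opD|exact: linear_op0].
Qed.

Lemma bounded_operatorP (T : H -> H) : bounded_operator T <->
  linear T /\ exists2 M : K, 0 <= M & forall x, `|T x| <= M * `|x|.
Proof.
split=> [[lT cT]|[lT [M M0 hM]]]; split => //.
  have /nbhs_ballP [d /= d0 hd] : nbhs (0 : H) (T @^-1` ball (T 0) 1).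
    by apply: cT; exact: nbhsx_ballx.
  have hd' y : `|y| < d -> `|T y| < 1.
    move=> yd; have /hd : ball (0 : H) d y by rewrite -ball_normE /= sub0r normrN.
    by rewrite /= -ball_normE /= linear_op0 // sub0r normrN.
  (* A vector rescaled to norm d / 2 lies strictly inside the ball of radius d, whence the factor
     2. *)
  exists (2 / d); first by rewrite divr_ge0 // ltW.
  move=> x; have [->|x0] := eqVneq x 0; first by rewrite linear_op0 // !normr0 mulr0.
  have nx : 0 < `|x| by rewrite normr_gt0.
  set c : K := d / 2 / `|x|.
  have c0 : 0 < c by rewrite !divr_gt0.
  have cx : `|c *: x| = d / 2.
    by rewrite normrZ gtr0_norm // /c mulfVK // gt_eqF.
  have := hd' (c *: x); rewrite cx ltr_pdivrMr // ltr_pMr // ltr1n => /(_ isT).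
  rewrite linear_opZ // normrZ gtr0_norm // => /ltW.
  rewrite -ler_pdivlMl // mulr1 /c !invfM !invrK => /le_trans; apply.
  by rewrite [d^-1 * _]mulrC.
have M1 : 0 < M + 1 by rewrite ltr_wpDl.
move=> x; apply/cvgrPdist_lt => eps eps0; apply/nbhs_ballP.
exists (eps / (M + 1)); first exact: divr_gt0.
move=> y; rewrite -ball_normE /= ltr_pdivlMr // mulrC; apply: le_lt_trans.
by rewrite -linear_opB // (le_trans (hM _)) // ler_wpM2r // lerDl.
Qed.

End InnerProduct.

(** * Approximation and total boundedness *)

Section Approximation.
Variables (K : numFieldType).

(** [K] is only partially ordered, so comparability has to be earned: x <= y + 1 makes y - x real,
    and then half of the gap x - y gives the usual contradiction. *)
Lemma le_addgt0 (x y : K) : (forall e, 0 < e -> x <= y + e) -> x <= y.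
Proof.
move=> h; have yx : y - x \is Num.real.
  have := h 1 ltr01; rewrite -subr_ge0 => /ger0_real h1.
  have -> : y - x = y + 1 - x - 1 by ring.
  by rewrite rpredB ?real1.
rewrite -subr_ge0; have [//|yx0] := real_leP (real0 _) yx.
have e0 : 0 < (x - y) / 2 by rewrite divr_gt0 // -opprB oppr_gt0.
have := h _ e0; rewrite -subr_ge0.
have -> : y + (x - y) / 2 - x = - ((x - y) / 2) by field.
by rewrite oppr_ge0 => /(lt_le_trans e0); rewrite ltxx.
Qed.

Lemma gt0_lower_bound (d e : K) : 0 < d -> 0 < e ->
  exists2 m, 0 < m & forall r, r < m -> r < d /\ r < e.
Proof.
move=> d0 e0; exists (d * e / (d + e)); first by rewrite divr_gt0 ?mulr_gt0 ?addr_gt0.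
have de0 : 0 < d + e by rewrite addr_gt0.
move=> r hr; split; apply: lt_le_trans hr _; rewrite ler_pdivrMr //.
- by rewrite ler_pM2l // lerDr ltW.
- by rewrite mulrC ler_pM2l // lerDl ltW.
Qed.

Lemma normr_le0_eps (V : normedModType K) (v : V) (M : K) : 0 <= M ->
  (forall e, 0 < e -> `|v| <= M * e) -> v = 0.
Proof.
move=> M0 h; apply/eqP; rewrite -normr_le0; apply: le_addgt0 => e e0.
have M1 : 0 < M + 1 by rewrite ltr_wpDl.
rewrite add0r (le_trans (h (e / (M + 1)) _)) ?divr_gt0 //.
by rewrite mulrA ler_pdivrMr // mulrC ler_pM2l // lerDl.
Qed.

Lemma dense_near (V : normedModType K) (S : set V) : dense S ->
  forall x (eps : K), 0 < eps -> exists2 y, S y & `|x - y| < eps.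
Proof.
move=> dS x eps eps0.
have [y [xy Sy]] : (ball x eps) `&` S !=set0.
  have [] := dS (ball x eps)^°.
  - by exists x; exact: nbhsx_ballx.
  - exact: open_interior.
  by move=> y [/interior_subset ? ?]; exists y.
by exists y => //; move: xy; rewrite -ball_normE.
Qed.

Lemma near_dense (V : normedModType K) (S : set V) :
  (forall x (eps : K), 0 < eps -> exists2 y, S y & `|x - y| < eps) -> dense S.
Proof.
move=> h O [x Ox] oO; have /nbhs_ballP [eps /= eps0 sO] : nbhs x O by exact: open_nbhs_nbhs.
have [y Sy xy] := h x eps eps0.
by exists y; split => //; apply: sO; rewrite -ball_normE.
Qed.

(** A Cauchy net without an order on its index: the sets {i | rho i < eps} generate the filter. The
    index is [nat] for the square-root iteration and the algebra itself for the extension to the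
    completion. *)
Lemma approx_limit (V : completeNormedModType K) (D : Type) (f : D -> V)
    (rho : D -> K) :
  (forall eps, 0 < eps -> exists i, rho i < eps) ->
  (forall i j, `|f i - f j| <= rho i + rho j) ->
  exists y, forall i, `|f i - y| <= rho i.
Proof.
move=> hrho hf.
have rho0 i : 0 <= rho i.
  have := le_trans (normr_ge0 _) (hf i i).
  by rewrite -mulr2n pmulrn_lge0.
pose G : set_system V := [set U | exists2 eps, 0 < eps & forall i, rho i < eps -> U (f i)].
have FG : ProperFilter G.
  split.
    by move=> [eps eps0 h]; have [i /h] := hrho _ eps0.
  split.
  - by exists 1.
  - move=> P Q [e e0 hP] [d d0 hQ]; have [m m0 hm] := gt0_lower_bound e0 d0.
    by exists m => // i /hm[/hP ? /hQ ?].
  - by move=> P Q PQ [e e0 hP]; exists e => // i /hP /PQ.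
have /cauchy_cvg/cvg_ex [y Gy] : cauchy G.
  apply: cauchy_exP => eps eps0.
  have e2 : 0 < eps / 2 by rewrite divr_gt0.
  have [i hi] := hrho _ e2.
  exists (f i); exists (eps / 2) => // j hj.
  rewrite -ball_normE /= (le_lt_trans (hf _ _)) //.
  by rewrite [eps]splitr ltrD.
exists y => i; apply: le_addgt0 => e e0.
have e2 : 0 < e / 2 by rewrite divr_gt0.
have [d d0 hd] : G (ball y (e / 2)) by apply: Gy; exact: nbhsx_ballx.
have [m m0 hm] := gt0_lower_bound d0 e2; have [j /hm[/hd jd je]] := hrho _ m0.
move: jd; rewrite -ball_normE /= distrC => /ltW jd.
rewrite -(subrKA (f j)) (le_trans (ler_normD _ _)) // (le_trans (lerD (hf _ _) jd)) //.
by rewrite -addrA lerD2l [leRHS]splitr lerD // ltW.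
Qed.

Definition totally_bounded (V : normedModType K) (A : set V) :=
  forall eps, 0 < eps -> exists s : seq V, forall x, A x ->
    exists2 y, y \in s & `|x - y| < eps.

Lemma sub_totally_bounded (V : normedModType K) (A B : set V) :
  A `<=` B -> totally_bounded B -> totally_bounded A.
Proof. by move=> AB h eps /h [s hs]; exists s => x /AB /hs. Qed.

Lemma totally_boundedD (V : normedModType K) (A B : set V) :
  totally_bounded A -> totally_bounded B ->
  totally_bounded [set z | exists x y, [/\ A x, B y & z = x + y]].
Proof.
move=> hA hB eps eps0; have e2 : 0 < eps / 2 by rewrite divr_gt0.
have [s hs] := hA _ e2; have [t ht] := hB _ e2.
exists [seq x + y | x <- s, y <- t] => _ [x [y [/hs[x' x's xx'] /ht[y' y't yy'] ->]]].
exists (x' + y'); first by apply/allpairsP; exists (x', y').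
by rewrite opprD addrACA (le_lt_trans (ler_normD _ _)) // [eps]splitr ltrD.
Qed.

(** Both norm limits pass through here: from finitely many basis vectors to T, and from [F, psi a]
    to [F, Psi c]. *)
Lemma totally_bounded_approx (V : normedModType K) (A : set V) :
  (forall eps, 0 < eps -> exists2 B, totally_bounded B &
     forall x, A x -> exists2 y, B y & `|x - y| < eps) ->
  totally_bounded A.
Proof.
move=> h eps eps0; have e2 : 0 < eps / 2 by rewrite divr_gt0.
have [B /(_ _ e2)[s hs] hB] := h _ e2.
exists s => x /hB [y /hs[z zs yz] xy]; exists z => //.
by rewrite -(subrKA y) (le_lt_trans (ler_normD _ _)) // [eps]splitr ltrD.
Qed.

(** An ultrafilter containing the closure of A contains one of finitely many eps-balls for every
    eps; it is thus Cauchy, and completeness gives its limit. *)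
Lemma totally_bounded_precompact (V : completeNormedModType K) (A : set V) :
  totally_bounded A -> precompact A.
Proof.
move=> hA; rewrite precompactE compact_ultra => F FU FA.
have /cauchy_cvg/cvg_ex [y Fy] : cauchy F.
  apply: cauchy_exP => eps eps0.
  have e2 : 0 < eps / 2 by rewrite divr_gt0.
  have [s hs] := hA _ e2.
  have : F [set x | exists2 y, y \in s & `|x - y| < eps].
    apply: filterS FA => x /(_ (ball x (eps / 2))) [].
      exact: nbhsx_ballx.
    move=> z [/hs[y ys zy]]; rewrite -ball_normE /= => xz; exists y => //.
    by rewrite -(subrKA z) (le_lt_trans (ler_normD _ _)) // [eps]splitr ltrD.
  elim: s {hs} => [|z s IH].
    by move=> h; exfalso; apply: (@filter_not_empty _ F _); apply: filterS h => x [].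
  move=> h; have [zF|zF] := in_ultra_setVsetC (ball z eps) FU; first by exists z.
  apply: IH; apply: filterS (filterI h zF) => x [[y]].
  rewrite inE => /orP[/eqP -> |ys xy _]; last by exists y.
  by rewrite -ball_normE /= distrC.
exists y; split => //; apply: closed_cvg Fy => //; exact: closed_closure.
Qed.

End Approximation.

(** * Square roots of positive operators *)

Section SquareRoot.
Variables (R : realType) (H : hilbertType R[i]).
Implicit Types x y : H.

Definition selfadjoint_contraction (T : H -> H) : Prop :=
  [/\ linear T, forall x, `|T x| <= `|x| & selfadjoint T].

(** Visser's iteration Y <- (B + Y^2) / 2 started at 0, aimed at 1 - sqrt(1 - B). *)
Fixpoint visser (B : H -> H) n : H -> H :=
  if n is m.+1 then fun x => 2^-1 *: (B x + visser B m (visser B m x)) else fun=> 0.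

(** The same iteration for the scalar B = 1, the worst case among contractions. *)
Fixpoint visser_bound n : R :=
  if n is m.+1 then (1 + visser_bound m ^+ 2) / 2 else 0.

Local Notation b := visser_bound.

Lemma visser_bound_itv n : 0 <= b n <= 1.
Proof. by elim: n => [|n /andP[b0 b1]] /=; nra. Qed.

Lemma visser_bound_incr n : b n <= b n.+1.
Proof. by have /andP[b0 b1] := visser_bound_itv n => /=; nra. Qed.

Lemma visser_boundS n : (b n.+1)%:C = (1 + (b n)%:C ^+ 2) / 2 :> R[i].
Proof. by rewrite /= rmorphM fmorphV rmorphD rmorphXn rmorph1 rmorph_nat. Qed.

Lemma visser_bound_cvg : exists2 l : R, 0 <= l <= 1 &
  (forall n, b n <= l) /\
  forall eps : R[i], 0 < eps -> exists n, (l - b n)%:C < eps.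
Proof.
have sb : has_sup (range b).
  split; first by exists (b 0%N), 0%N.
  by exists 1 => _ [n _ <-]; have /andP[] := visser_bound_itv n.
have le_l n : b n <= sup (range b) by apply: ub_le_sup; [exact: sb.2|exists n].
exists (sup (range b)); last split => // eps eps0.
  apply/andP; split; first exact: (le_l 0%N).
  by apply: ge_sup; [exact: sb.1|move=> _ [n _ <-]; have /andP[] := visser_bound_itv n].
move: eps0; rewrite ltcE /= => /andP[/eqP im0 re0].
have [_ [n _ <-] hn] := sup_adherent re0 sb.
by exists n; rewrite ltcE /= im0 eqxx /= ltrBlDr -ltrBlDl.
Qed.

Section Iteration.
Variable B : H -> H.
Hypothesis hB : selfadjoint_contraction B.
Local Notation Y := (visser B).

Lemma visser_linear n : linear (Y n).
Proof.
have [lB _ _] := hB.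
elim: n => [|n IH] c x y /=; first by rewrite scaler0 addr0.
by rewrite lB !IH !(scalerDr, scalerA) -!addrA mulrC; congr (_ + _); rewrite addrCA.
Qed.

Lemma visser_selfadjoint n : selfadjoint (Y n).
Proof.
have [_ _ sB] := hB.
elim: n => [|n IH] x y /=; first by rewrite dotp0l dotp0r.
by rewrite dotpZl dotpZr fmorphV rmorph_nat dotpDl dotpDr sB !IH.
Qed.

Lemma visser_norm n x : `|Y n x| <= (b n)%:C * `|x|.
Proof.
have [_ cB _] := hB.
elim: n x => [|n IH] x; first by rewrite normr0 mul0r.
have -> : (b n.+1)%:C * `|x| = 2^-1 * (`|x| + (b n)%:C * ((b n)%:C * `|x|)).
  by rewrite visser_boundS; ring.
rewrite /= normrZ normfV normr_nat ler_pM2l ?invr_gt0 //.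
have b0 : 0 <= (b n)%:C :> R[i] by rewrite ler0c; have /andP[] := visser_bound_itv n.
rewrite (le_trans (ler_normD _ _)) // lerD // (le_trans (IH _)) //.
by rewrite ler_wpM2l.
Qed.

(** The telescoping Y'^2 - Y^2 = Y' (Y' - Y) + (Y' - Y) Y holds without commutation, so the iterates
    need not be viewed as polynomials in B. *)
Lemma visser_step n x : `|Y n.+1 x - Y n x| <= (b n.+1 - b n)%:C * `|x|.
Proof.
have [lB cB _] := hB.
elim: n x => [|n IH] x.
  rewrite /= addr0 subr0 normrZ normfV normr_nat expr0n addr0 subr0 mul1r.
  by rewrite fmorphV rmorph_nat ler_pM2l ?invr_gt0.
have b0 m : 0 <= (b m)%:C :> R[i] by rewrite ler0c; have /andP[] := visser_bound_itv m.
have -> : Y n.+2 x - Y n.+1 x =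
    2^-1 *: (Y n.+1 (Y n.+1 x - Y n x) + (Y n.+1 (Y n x) - Y n (Y n x))).
  rewrite (linear_opB _ _ (visser_linear n.+1)) subrKA.
  by rewrite [Y n.+2 x]/= [Y n.+1 x in X in _ - X]/= -scalerBr opprD addrACA subrr add0r.
have -> : (b n.+2 - b n.+1)%:C * `|x| = 2^-1 *
   ((b n.+1)%:C * ((b n.+1 - b n)%:C * `|x|) + (b n.+1 - b n)%:C * ((b n)%:C * `|x|)).
  transitivity (((1 + (b n.+1)%:C ^+ 2) / 2 - (1 + (b n)%:C ^+ 2) / 2) * `|x|).
    by rewrite -!visser_boundS rmorphB.
  by rewrite rmorphB; ring.
rewrite normrZ normfV normr_nat ler_pM2l ?invr_gt0 //.
rewrite (le_trans (ler_normD _ _)) // lerD //.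
  by rewrite (le_trans (visser_norm _ _)) // ler_wpM2l.
rewrite (le_trans (IH _)) // ler_wpM2l ?visser_norm // ler0c subr_ge0.
exact: visser_bound_incr.
Qed.

Lemma visser_cauchy m n x : (m <= n)%N -> `|Y n x - Y m x| <= (b n - b m)%:C * `|x|.
Proof.
move=> /subnK <-; elim: (n - m)%N => [|k IH].
  by rewrite add0n !subrr normr0 mul0r.
rewrite addSn -(subrKA (Y (k + m)%N x)) (le_trans (ler_normD _ _)) //.
rewrite -(subrKA (b (k + m)%N)) rmorphD mulrDl lerD //; exact: visser_step.
Qed.

(* With D = Y_{n+1} - Y_n, the next increment is (Y_{n+1} D + D Y_n) / 2, so the
   scalar iteration [visser_bound] dominates the increments in operator norm and
   Y_n converges in norm to a solution of Y = (B + Y^2) / 2. *)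
Lemma sqrt_one_minus : exists2 Y, selfadjoint_contraction Y &
  forall x, (x - Y x) - Y (x - Y x) = x - B x.
Proof.
have [lB cB sB] := hB.
have [l /andP[l0 l1] [bl hl]] := visser_bound_cvg.
have bl0 m : 0 <= (l - b m)%:C :> R[i] by rewrite ler0c subr_ge0.
have b1 m : (b m)%:C <= 1 :> R[i].
  by rewrite (_ : 1 = 1%:C) // lecR; have /andP[] := visser_bound_itv m.
have hl' x (eps : R[i]) : 0 < eps -> exists n, (l - b n)%:C * `|x| < eps.
  move=> eps0; have x1 : 0 < `|x| + 1 by rewrite ltr_wpDl.
  have [n hn] := hl (eps / (`|x| + 1)) (divr_gt0 eps0 x1).
  exists n; rewrite ltr_pdivlMr // in hn.
  by apply: le_lt_trans hn; rewrite ler_wpM2l // lerDl.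
have /choice [Z hZ] x : exists y, forall n, `|visser B n x - y| <= (l - b n)%:C * `|x|.
  apply: approx_limit (hl' x) _ => i j.
  wlog ij : i j / (i <= j)%N.
    move=> h; have [/h //|/ltnW /h ji] := leqP i j.
    by rewrite distrC [leRHS]addrC.
  rewrite distrC (le_trans (visser_cauchy _ ij)) // -[leLHS]addr0 lerD //.
    by rewrite ler_wpM2r // lecR lerD2r.
  by rewrite mulr_ge0.
(* [Z] is chosen pointwise, so even its linearity must be recovered from the uniqueness of the
   limit. *)
have eqZ x y (M : R[i]) : 0 <= M ->
    (forall n, `|y - visser B n x| <= (l - b n)%:C * M) -> Z x = y.
  move=> M0 h; apply/eqP; rewrite -subr_eq0; apply/eqP.
  apply: (@normr_le0_eps _ _ _ (`|x| + M)); first by rewrite addr_ge0.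
  move=> e e0; have [n /ltW hn] := hl _ e0.
  rewrite -(subrKA (visser B n x)) (le_trans (ler_normD _ _)) // mulrDl lerD //.
    by rewrite distrC (le_trans (hZ _ _)) // mulrC ler_wpM2l.
  by rewrite distrC (le_trans (h _)) // mulrC ler_wpM2l.
have lZ : linear Z.
  move=> c x y; apply: (@eqZ _ _ (`|c| * `|x| + `|y|)) => [|n].
    by rewrite addr_ge0 // mulr_ge0.
  rewrite visser_linear opprD addrACA -scalerBr (le_trans (ler_normD _ _)) // mulrDr lerD //.
    by rewrite normrZ mulrCA ler_wpM2l // distrC.
  by rewrite distrC.
have cZ x : `|Z x| <= `|x|.
  apply: le_addgt0 => e e0; have [n /ltW hn] := hl' x _ e0.
  rewrite -(subrK (visser B n x) (Z x)) addrC (le_trans (ler_normD _ _)) // lerD //.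
    by rewrite (le_trans (visser_norm _ _)) // ler_piMl.
  by rewrite distrC (le_trans (hZ _ _)).
have sZ : selfadjoint Z.
  move=> x y; apply/eqP; rewrite -subr_eq0; apply/eqP.
  apply: (@normr_le0_eps _ R[i]^o _ (2 * (`|x| * `|y|))); first by rewrite !mulr_ge0.
  move=> e e0; have [n /ltW hn] := hl _ e0.
  rewrite -(subrKA (dotp (visser B n x) y)) {2}visser_selfadjoint -dotpBl -dotpBr.
  rewrite (le_trans (ler_normD _ _)) // -mulrA mulr_natl mulr2n lerD //.
    rewrite (le_trans (dotp_le _ _)) // mulrAC ler_wpM2r //.
    by rewrite distrC (le_trans (hZ _ _)) // mulrC ler_wpM2l.
  rewrite (le_trans (dotp_le _ _)) // -mulrA ler_wpM2l //.
  by rewrite (le_trans (hZ _ _)) // mulrC ler_wpM2l.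
exists Z => // x.
have ZE : Z x = 2^-1 *: (B x + Z (Z x)).
  apply/eqP; rewrite -subr_eq0; apply/eqP.
  apply: (@normr_le0_eps _ _ _ (2 * `|x|)); first by rewrite mulr_ge0.
  move=> e e0; have [n /ltW hn] := hl _ e0.
  rewrite -(subrKA (visser B n.+1 x)) (le_trans (ler_normD _ _)) //.
  rewrite -mulrA mulr_natl mulr2n lerD //.
    rewrite distrC (le_trans (hZ _ _)) // mulrC ler_wpM2l // (le_trans _ hn) //.
    by rewrite lecR lerD2l lerN2 visser_bound_incr.
  rewrite /= -scalerBr opprD addrACA subrr add0r normrZ normfV normr_nat ler_pdivrMl // mulr_natl mulr2n.
  rewrite -(subrKA (visser B n (Z x))) -linear_opB; last exact: visser_linear.
  rewrite (le_trans (ler_normD _ _)) // lerD //.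
    rewrite (le_trans (visser_norm _ _)) // (le_trans (ler_piMl _ (b1 n))) //.
    by rewrite (le_trans (hZ _ _)) // mulrC ler_wpM2l.
  by rewrite (le_trans (hZ _ _)) // mulrC ler_pM.
rewrite linear_opB //; move: ZE; set ZZ := Z (Z x) => ZE.
have : B x = 2 *: Z x - ZZ.
  by rewrite ZE scalerA mulfV ?pnatr_eq0 // scale1r addrK.
move=> ->; rewrite scaler_nat mulr2n !opprD !opprK !addrA; congr (_ + _).
Qed.

End Iteration.
End SquareRoot.

(** * Orthonormal bases *)

Section Orthonormal.
Variables (K : numClosedFieldType) (H : hilbertType K) (I : choiceType) (e : I -> H).
Implicit Types (x y : H) (s t : seq I).

Definition basis_proj s x : H := \sum_(k <- s) dotp x (e k) *: e k.
Local Notation P := basis_proj.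

Lemma basis_projD s x y : P s (x + y) = P s x + P s y.
Proof. by rewrite -big_split; apply: eq_bigr => k _; rewrite dotpDl scalerDl. Qed.

Lemma basis_projN s x : P s (- x) = - P s x.
Proof. by rewrite -sumrN; apply: eq_bigr => k _; rewrite dotpNl scaleNr. Qed.

Lemma basis_projZ s c x : P s (c *: x) = c *: P s x.
Proof. by rewrite scaler_sumr; apply: eq_bigr => k _; rewrite dotpZl scalerA. Qed.

Hypothesis oe : forall k l, dotp (e k) (e l) = (k == l)%:R.

Lemma norm_basis k : `|e k| = 1.
Proof.
by apply/eqP; rewrite -(@pexpr_eq1 _ _ 2%N) // -dotp_norm oe eqxx.
Qed.

Lemma dotp_basis_proj s x k : uniq s ->
  dotp (P s x) (e k) = if k \in s then dotp x (e k) else 0.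
Proof.
move=> us; rewrite dotp_suml.
under eq_bigr => l _ do rewrite dotpZl oe.
case: ifPn => ks.
  rewrite (bigD1_seq k) //= eqxx mulr1 big1 ?addr0 // => l /negPf lk.
  by rewrite lk mulr0.
rewrite big1_seq // => l /= ls; have [lk|] := eqVneq l k; last by rewrite mulr0.
by rewrite -lk ls in ks.
Qed.

Lemma norm_sub_basis_proj s x : uniq s ->
  `|x - P s x| ^+ 2 = `|x| ^+ 2 - \sum_(k <- s) `|dotp x (e k)| ^+ 2.
Proof.
move=> us; rewrite -!dotp_norm [LHS]dotpBl [in X in _ - X]dotp_suml [X in _ - X]big1_seq; last first.
  by move=> k /= ks; rewrite dotpZl [dotp (e k) _]dotpC dotpBl dotp_basis_proj // ks subrr conjC0 mulr0.
rewrite subr0 dotpBr dotp_sumr; congr (_ - _); apply: eq_bigr => k _.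
by rewrite dotpZr normCKC.
Qed.

Lemma bessel s x : uniq s -> \sum_(k <- s) `|dotp x (e k)| ^+ 2 <= `|x| ^+ 2.
Proof. by move=> us; rewrite -subr_ge0 -norm_sub_basis_proj // exprn_ge0. Qed.

Lemma norm_sub_basis_proj_le s x : uniq s -> `|x - P s x| <= `|x|.
Proof.
move=> us; rewrite -(@ler_pXn2r _ 2%N) ?nnegrE // norm_sub_basis_proj //.
by rewrite gerBl sumr_ge0 // => k _; rewrite exprn_ge0.
Qed.

Hypothesis de : dense [set x | exists s : seq (K * I), x = \sum_(p <- s) p.1 *: e p.2].

(** Once t contains the indices of a finite combination y near x, P_t y = y and x - P_t x = (1 -
    P_t)(x - y). The claim covers all larger t so that several vectors can share one t. *)
Lemma basis_proj_approx x (eps : K) : 0 < eps -> exists t0, forall t,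
  uniq t -> {subset t0 <= t} -> `|x - P t x| < eps.
Proof.
move=> eps0; have [_ [s ->] xy] := dense_near de x eps0.
exists (map snd s) => t ut st.
set y := \sum_(p <- s) _ in xy.
have Py : P t y = y.
  have -> : P t y = \sum_(p <- s) P t (p.1 *: e p.2).
    apply: (big_morph (P t) (basis_projD t)).
    by rewrite /P big1 // => k _; rewrite dotp0l scale0r.
  rewrite /y !big_seq; apply: eq_bigr => p ps; rewrite basis_projZ; congr (_ *: _).
  rewrite /P (bigD1_seq p.2) //=; last by apply: st; apply: map_f.
  rewrite oe eqxx scale1r big1 ?addr0 // => k.
  by rewrite oe eq_sym => /negPf ->; rewrite scale0r.
apply: le_lt_trans xy.
have -> : x - P t x = (x - y) - P t (x - y).
  by rewrite basis_projD basis_projN Py opprB addrA subrK.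
exact: norm_sub_basis_proj_le.
Qed.

Lemma basis_ind (Q : H -> Prop) : Q 0 ->
  (forall c k y, Q y -> Q (c *: e k + y)) ->
  (forall x, (forall eps : K, 0 < eps -> exists2 y, Q y & `|x - y| < eps) -> Q x) ->
  forall x, Q x.
Proof.
move=> Q0 QS Qcl x; apply: Qcl => eps eps0.
have [_ [s ->] xy] := dense_near de x eps0.
exists (\sum_(p <- s) p.1 *: e p.2) => //.
elim: s {xy} => [|p s IH]; first by rewrite big_nil.
by rewrite big_cons; exact: QS.
Qed.

Lemma bounded_operator_basis_eq (S T : H -> H) :
  bounded_operator S -> bounded_operator T ->
  (forall k, S (e k) = T (e k)) -> forall x, S x = T x.
Proof.
move=> /bounded_operatorP[lS [M M0 hM]] /bounded_operatorP[lT [N N0 hN]] ST.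
apply: basis_ind => [|c k y IH|x hx]; first by rewrite !linear_op0.
  by rewrite lS lT ST IH.
apply/eqP; rewrite -subr_eq0; apply/eqP.
apply: (@normr_le0_eps _ _ _ (M + N)) => [|d d0]; first by rewrite addr_ge0.
have [y Sy /ltW xy] := hx _ d0.
rewrite -(subrKA (S y)) -linear_opB // Sy -linear_opB // (le_trans (ler_normD _ _)) //.
rewrite mulrDl lerD //.
  by rewrite (le_trans (hM _)) // ler_wpM2l.
by rewrite (le_trans (hN _)) // ler_wpM2l // distrC.
Qed.

Lemma dotp_basis_eq x y : (forall k, dotp x (e k) = dotp y (e k)) -> x = y.
Proof.
move=> h; apply: dotp_eq; apply: basis_ind => [|c k z IH|z hz].
- by rewrite !dotp0r.
- by rewrite !dotpDr !dotpZr h IH.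
apply/eqP; rewrite -subr_eq0; apply/eqP; rewrite -dotpBl.
apply: (@normr_le0_eps _ K^o _ `|x - y|) => // d d0.
have [w xyw /ltW zw] := hz _ d0.
rewrite -(subrK w z) dotpDr (_ : dotp (x - y) w = 0) ?addr0; last first.
  by rewrite dotpBl xyw subrr.
by rewrite (le_trans (dotp_le _ _)) // ler_wpM2l.
Qed.

(** Summability is encoded as a bound on all finite partial sums. The condition depends on the basis
    and is stronger than trace class: the rank-one operator <., v> w, w nonzero, satisfies it only
    if v has absolutely summable coefficients. *)
Definition basis_summable (T : H -> H) : Prop :=
  exists M : K, forall s, uniq s -> \sum_(k <- s) `|T (e k)| <= M.

Lemma basis_summableD (S T : H -> H) :
  basis_summable S -> basis_summable T -> basis_summable (fun x => S x + T x).
Proof.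
move=> [M hM] [N hN]; exists (M + N) => s us.
apply: le_trans (lerD (hM s us) (hN s us)); rewrite -big_split.
by apply: ler_sum => k _; exact: ler_normD.
Qed.

Lemma basis_summable_compl (S T : H -> H) : bounded_operator S ->
  basis_summable T -> basis_summable (fun x => S (T x)).
Proof.
move=> /bounded_operatorP[_ [N N0 hN]] [M hM]; exists (N * M) => s us.
apply: le_trans (ler_wpM2l N0 (hM s us)); rewrite mulr_sumr.
by apply: ler_sum => k _; exact: hN.
Qed.

Lemma basis_summable_eq (S T : H -> H) :
  (forall x, S x = T x) -> basis_summable S -> basis_summable T.
Proof.
by move=> ST [M hM]; exists M => s us; under eq_bigr => k _ do rewrite -ST; exact: hM.
Qed.

End Orthonormal.

(** * A criterion for trace class *)

Section TraceClass.
Variables (R : realType) (H : hilbertType R[i]).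

(* With D = D^*, expanding each D f_k over e and exchanging the two finite
   sums turns the left-hand side into sums of |<f_k, D e_l>|^2, to which Bessel
   applies. *)
Lemma sum_sqnorm_basis_change (I J : choiceType) (e : I -> H) (f : J -> H)
    (D : H -> H) (C : R[i]) :
  orthonormal_basis e -> (forall k l, dotp (f k) (f l) = (k == l)%:R) ->
  selfadjoint D ->
  (forall s, uniq s -> \sum_(l <- s) `|D (e l)| ^+ 2 <= C) ->
  forall s, uniq s -> \sum_(k <- s) `|D (f k)| ^+ 2 <= C.
Proof.
move=> [oe de] of_ sD hC s us; apply: le_addgt0 => eps eps0.
have s1 : 0 < (size s)%:R + 1 :> R[i] by rewrite ltr_wpDl.
(* Each of the [size s] vectors may lose d; the added 1 covers the empty sequence. *)
set d := eps / ((size s)%:R + 1); have d0 : 0 < d by rewrite divr_gt0.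
have [t ut ht] : exists2 t, uniq t & forall k, k \in s ->
    `|D (f k)| ^+ 2 <= \sum_(l <- t) `|dotp (D (f k)) (e l)| ^+ 2 + d.
  have [t0 ht0] : exists t0 : seq I, forall k, k \in s -> forall t, uniq t ->
      {subset t0 <= t} -> `|D (f k) - basis_proj e t (D (f k))| < sqrtC d.
    elim: (s) => [|k s' [t1 IH]]; first by exists [::].
    have d' : 0 < sqrtC d by rewrite sqrtC_gt0.
    have [t2 h2] := basis_proj_approx oe de (D (f k)) d'.
    exists (t1 ++ t2) => k' kk t ut tt.
    have t1t : {subset t1 <= t} by move=> z zt; apply: tt; rewrite mem_cat zt.
    have t2t : {subset t2 <= t} by move=> z zt; apply: tt; rewrite mem_cat zt orbT.
    by move: kk; rewrite inE => /orP[/eqP ->|/IH]; [exact: h2|exact].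
  exists (undup t0); first exact: undup_uniq.
  move=> k ks; rewrite -lerBlDl -norm_sub_basis_proj ?undup_uniq //.
  rewrite -[leRHS]sqrtCK ler_pXn2r ?nnegrE ?sqrtC_ge0 ?(ltW d0) //.
  by apply/ltW/ht0 => [//||z]; rewrite ?undup_uniq // mem_undup.
apply: (@le_trans _ _ (\sum_(k <- s) (\sum_(l <- t) `|dotp (f k) (D (e l))| ^+ 2 + d))).
  rewrite !big_seq; apply: ler_sum => k ks.
  by under eq_bigr => l _ do rewrite -sD; exact: ht.
rewrite big_split /= lerD //.
  rewrite exchange_big /=; apply: le_trans (hC t ut); apply: ler_sum => l _.
  apply: le_trans (bessel of_ (D (e l)) us); apply: ler_sum => k _.
  by rewrite dotpC norm_conjC.
rewrite big_const_seq count_predT iter_addr_0 -mulr_natl.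
by rewrite /d mulrCA ger_pMr // ler_pdivrMr // mul1r lerDl.
Qed.

Lemma sum_lt_pinfty (J : choiceType) (g : J -> R) (C : R) :
  (forall s, uniq s -> \sum_(k <- s) g k <= C) ->
  (\esum_(k in [set: J]) (g k)%:E < +oo)%E.
Proof.
move=> h; apply: (@le_lt_trans _ _ C%:E); last exact: ltry.
apply: ge_ereal_sup => _ [A [fA _] <-].
by rewrite fsbig_finite // sumEFin lee_fin; apply: h; exact: fset_uniq.
Qed.

Lemma Re_sum (J : Type) (s : seq J) (g : J -> R[i]) :
  complex.Re (\sum_(k <- s) g k) = \sum_(k <- s) complex.Re (g k).
Proof.
by elim: s => [|k s IH]; rewrite ?big_nil // !big_cons -IH; case: (g k); case: (\sum_(_ <- _) _).
Qed.

(** This makes B = 1 - T^* T / M^2 admissible for [sqrt_one_minus], which then gives a root of T^* T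
    / M^2. In the expanded square, |T' T x| <= M |T x| absorbs the quadratic term. *)
Lemma contraction_sub_adjoint (T T' : H -> H) (M : R[i]) : 0 < M ->
  linear T -> linear T' -> (forall x y, dotp (T x) y = dotp x (T' y)) ->
  (forall x, `|T' x| <= M * `|x|) ->
  selfadjoint_contraction (fun x => x - M ^- 2 *: T' (T x)).
Proof.
move=> M0 lT lT' adj bT'.
have M2 : (M ^- 2)^* = M ^- 2 by apply/CrealP; rewrite ger0_real // invr_ge0 exprn_ge0 // ltW.
have adj' x y : dotp (T' x) y = dotp x (T y) by rewrite dotpC -adj -dotpC.
split.
- move=> c x y; rewrite lT lT' scalerBr scalerDr !scalerA [c * _]mulrC.
  by rewrite opprD addrACA.
- move=> x; rewrite -(@ler_pXn2r _ 2%N) ?nnegrE // -!dotp_norm dotpBl !dotpBr.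
  rewrite !dotpZl !dotpZr M2 -!adj adj' !dotp_norm adj dotp_norm.
  rewrite -subr_ge0.
  have -> : `|x| ^+ 2 - (`|x| ^+ 2 - M ^- 2 * `|T x| ^+ 2 -
      (M ^- 2 * `|T x| ^+ 2 - M ^- 2 * (M ^- 2 * `|T' (T x)| ^+ 2))) =
      M ^- 2 * (2 * `|T x| ^+ 2 - M ^- 2 * `|T' (T x)| ^+ 2) by ring.
  rewrite mulr_ge0 ?invr_ge0 ?exprn_ge0 ?(ltW M0) // subr_ge0.
  apply: (@le_trans _ _ (`|T x| ^+ 2)); last by rewrite mulr_natl mulr2n lerDl exprn_ge0.
  rewrite ler_pdivrMl ?exprn_gt0 // -exprMn ler_pXn2r ?nnegrE // ?mulr_ge0 ?(ltW M0) //.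
- move=> x y; rewrite dotpBl dotpBr dotpZl dotpZr M2 adj'.
  by rewrite -adj.
Qed.

(** P = M (1 - Y) with (1 - Y)^2 = T^* T / M^2 is |T|. A second root D gives <P x, x> = 2 M |D x|^2,
    which proves positivity of P and allows the change of basis. *)
Lemma trace_class_of_summable (I : choiceType) (e : I -> H) (T T' : H -> H) :
  orthonormal_basis e -> bounded_operator T -> bounded_operator T' ->
  (forall x y, dotp (T x) y = dotp x (T' y)) ->
  basis_summable e T -> trace_class T.
Proof.
move=> he bT bT' adj [C hC]; split => //.
have [lT _] := bT; have [lT' [M1 M10 hM]] := (bounded_operatorP T').1 bT'.
set M := M1 + 1; have M0 : 0 < M by rewrite ltr_wpDl.
have hM' x : `|T' x| <= M * `|x|.
  by rewrite (le_trans (hM x)) // ler_wpM2r // lerDl.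
have MC : M^* = M by apply/CrealP; rewrite gtr0_real.
have [Y scY hY] := sqrt_one_minus (contraction_sub_adjoint M0 lT lT' adj hM').
have [lY cY sY] := scY.
have hY' x : x - Y x - Y (x - Y x) = M ^- 2 *: T' (T x).
  by rewrite hY opprB addrC subrK.
pose P x := M *: (x - Y x).
have lP : linear P.
  move=> c x y; rewrite /P lY opprD addrACA -scalerBr scalerDr !scalerA.
  by rewrite mulrC.
have adj' x y : dotp (T' x) y = dotp x (T y) by rewrite dotpC -adj -dotpC.
have PP x y : dotp (P (P x)) y = dotp (T x) (T y).
  rewrite /P linear_opZ // -scalerBr hY' !scalerA -expr2 mulfV ?expf_neq0 ?gt_eqF //.
  by rewrite scale1r adj'.
(* Here 1 - (1 + Y) / 2 = P / (2 M), the source of the factor 2 M below. *)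
have scB : selfadjoint_contraction (fun x => 2^-1 *: (x + Y x)).
  split=> [c x y|x|x y].
  - by rewrite lY addrACA -scalerDr [LHS]scalerDr !scalerA [c * _]mulrC.
  - rewrite normrZ normfV normr_nat ler_pdivrMl // mulr_natl mulr2n.
    by rewrite (le_trans (ler_normD _ _)) // lerD.
  - by rewrite dotpZl dotpZr fmorphV rmorph_nat dotpDl dotpDr sY.
have [Z [lZ cZ sZ] hZ] := sqrt_one_minus scB.
pose D x := x - Z x.
have sD : selfadjoint D by move=> x y; rewrite dotpBl dotpBr sZ.
have PD x : dotp (P x) x = 2 * M * `|D x| ^+ 2.
  rewrite -dotp_norm sD /D hZ dotpBr dotpZr fmorphV rmorph_nat dotpDr /P dotpZl dotpBl sY.
  by field.
have sP : selfadjoint P.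
  by move=> x y; rewrite /P dotpZl dotpZr MC dotpBl dotpBr sY.
have PT x : `|P x| = `|T x|.
  by apply/eqP; rewrite -(@eqrXn2 _ 2%N) // -!dotp_norm -PP [dotp (P (P x)) x]sP.
exists P; first split => //; first split.
- apply/bounded_operatorP; split => //; exists (M * 2); first by rewrite mulr_ge0 // ltW.
  move=> x; rewrite normrZ gtr0_norm // -mulrA ler_pM2l // mulr_natl mulr2n.
  by rewrite (le_trans (ler_normD _ _)) // normrN lerD.
- by move=> x; rewrite PD !mulr_ge0 ?exprn_ge0 // ltW.
move=> J f [of_ _].
have De s : uniq s -> \sum_(l <- s) `|D (e l)| ^+ 2 <= C / (2 * M).
  move=> us; rewrite ler_pdivlMr ?mulr_gt0 // mulrC mulr_sumr.
  apply: le_trans (hC s us); apply: ler_sum => l _.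
  rewrite -PD -PT -[leRHS]mulr1 -[in leRHS](norm_basis he.1 l).
  apply: le_trans (dotp_le _ _); apply: real_ler_norm.
  by rewrite ger0_real // PD !mulr_ge0 ?exprn_ge0 // ltW.
have Df := sum_sqnorm_basis_change he of_ sD De.
apply: (@sum_lt_pinfty _ _ (complex.Re C)) => s us.
rewrite -Re_sum.
have : \sum_(k <- s) dotp (P (f k)) (f k) <= C.
  have := Df s us; rewrite ler_pdivlMr ?mulr_gt0 // mulrC mulr_sumr; apply: le_trans.
  by apply: ler_sum => k _; rewrite PD.
by rewrite lecE => /andP[].
Qed.

End TraceClass.

(** * Compactness and separability *)

Section Compactness.
Variables (R : realType) (H : hilbertType R[i]).

Lemma itv_net (d : R) : 0 < d ->
  exists g : seq R, forall a, `|a| <= 1 -> exists2 y, y \in g & `|a - y| < d.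
Proof.
move=> d0; exists [seq k%:R * d - 1 | k <- iota 0 (Num.truncn (2 / d)).+1] => a.
rewrite ler_norml => /andP[a1 a2].
have ad0 : 0 <= (a + 1) / d by rewrite divr_ge0 ?(ltW d0) // -lerBlDr sub0r.
have /andP[h1 h2] := truncn_itv ad0.
exists ((Num.truncn ((a + 1) / d))%:R * d - 1).
  apply/mapP; exists (Num.truncn ((a + 1) / d)) => //; rewrite mem_iota /= add0n ltnS; apply: le_truncn.
  by rewrite ler_pM2r ?invr_gt0 // -[2]/(1 + 1) lerD2r.
move: h1 h2; rewrite ler_pdivlMr // ltr_pdivrMr // -natr1 mulrDl mul1r => h1 h2.
by rewrite ltr_norml; apply/andP; split; lra.
Qed.

Lemma norm_complex_le (c : R[i]) (a b : R) :
  `|c - Complex a b| <= (`|complex.Re c - a| + `|complex.Im c - b|)%:C.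
Proof.
have -> : c - Complex a b = (complex.Re c - a)%:C + 'i%C * (complex.Im c - b)%:C.
  by rewrite {1}(complexE c) {1}(complexE (Complex a b)) /= !rmorphB; ring.
apply: le_trans (ler_normD _ _) _.
rewrite normrM complexiE normCi mul1r !normc_def /= expr0n /= !addr0 !sqrtr_sqr.
by rewrite -rmorphD.
Qed.

Lemma disc_net (eps : R[i]) : 0 < eps ->
  exists g : seq R[i], forall c : R[i], `|c| <= 1 -> exists2 z, z \in g & `|c - z| < eps.
Proof.
rewrite ltcE /= => /andP[/eqP eps_im eps_re].
have d0 : 0 < complex.Re eps / 2 by rewrite divr_gt0.
have [g hg] := itv_net d0; exists [seq Complex a b | a <- g, b <- g] => c c1.
have re1 : `|complex.Re c| <= 1 by rewrite -lecR; exact: le_trans (normc_ge_Re c) c1.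
have im1 : `|complex.Im c| <= 1.
  rewrite -normrN -ReiNIm -lecR; apply: le_trans (normc_ge_Re _) _.
  by rewrite normrM complexiE normCi mulr1.
have [a ag ha] := hg _ re1; have [b bg hb] := hg _ im1.
exists (Complex a b); first by apply/allpairsP; exists (a, b).
apply: le_lt_trans (norm_complex_le c a b) _.
by rewrite ltcE /= eps_im eqxx /= [ltRHS]splitr ltrD.
Qed.

Lemma rat_complex_dense (c eps : R[i]) : 0 < eps ->
  exists a b : rat, `|c - Complex (ratr a) (ratr b)| < eps.
Proof.
rewrite ltcE /= => /andP[/eqP eps_im eps_re].
have d0 : 0 < complex.Re eps / 2 by rewrite divr_gt0.
have rat_near (x : R) : exists a : rat, `|x - ratr a| < complex.Re eps / 2.
  have : x - complex.Re eps / 2 < x + complex.Re eps / 2 by lra.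
  move=> /rat_in_itvoo [a]; rewrite in_itv /= => /andP[h1 h2]; exists a.
  by rewrite ltr_norml; apply/andP; split; lra.
have [a ha] := rat_near (complex.Re c); have [b hb] := rat_near (complex.Im c).
exists a, b; apply: le_lt_trans (norm_complex_le c _ _) _.
by rewrite ltcE /= eps_im eqxx /= [ltRHS]splitr ltrD.
Qed.

Lemma totally_bounded_disc (v : H) :
  totally_bounded [set x | exists2 c : R[i], `|c| <= 1 & x = c *: v].
Proof.
move=> eps eps0; have v1 : 0 < `|v| + 1 by rewrite ltr_wpDl.
have [g hg] := disc_net (divr_gt0 eps0 v1).
exists [seq c *: v | c <- g] => _ [c /hg[z zg cz] ->].
exists (z *: v); first exact: map_f.
rewrite -scalerBl normrZ; move: cz; rewrite ltr_pdivlMr //; apply: le_lt_trans.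
by rewrite ler_wpM2l // lerDl.
Qed.

Lemma totally_bounded_lincomb (I : Type) (s : seq I) (v : I -> H) :
  totally_bounded [set x | exists2 c : I -> R[i], forall k, `|c k| <= 1 &
    x = \sum_(k <- s) c k *: v k].
Proof.
elim: s => [|k s IH].
  move=> eps eps0; exists [:: 0] => _ [c _ ->]; exists 0; first by rewrite inE.
  by rewrite big_nil subr0 normr0.
apply: sub_totally_bounded (totally_boundedD (totally_bounded_disc (v k)) IH).
move=> _ [c hc ->]; exists (c k *: v k), (\sum_(k <- s) c k *: v k).
by rewrite big_cons; split => //; [exists (c k)|exists c].
Qed.

Variables (I : choiceType) (e : I -> H).
Hypothesis he : orthonormal_basis e.

(** Choose s with partial sum within eps of the supremum: a disjoint t can add at most eps. The
    supremum lives in [R], hence the real parts. *)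
Lemma basis_summable_tail (T : H -> H) (eps : R[i]) : 0 < eps ->
  basis_summable e T -> exists2 s, uniq s & forall t : seq I, uniq t ->
    (forall k, k \in t -> k \notin s) -> \sum_(k <- t) `|T (e k)| <= eps.
Proof.
move=> eps0 [M hM].
have realS s : complex.Im (\sum_(k <- s) `|T (e k)|) = 0.
  by apply: ger0_Im; rewrite sumr_ge0.
pose S := [set r : R | exists2 s, uniq s & r = complex.Re (\sum_(k <- s) `|T (e k)|)].
have supS : has_sup S.
  split; first by exists (complex.Re (\sum_(k <- [::]) `|T (e k)|)), [::].
  exists (complex.Re M) => _ [s us ->].
  by have := hM s us; rewrite lecE => /andP[].
move: eps0; rewrite ltcE /= => /andP[/eqP eps_im eps_re].
have [_ [s us ->] hs] := sup_adherent eps_re supS.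
exists s => // t ut ts; rewrite lecE realS eps_im eqxx /=.
have : S (complex.Re (\sum_(k <- s ++ t) `|T (e k)|)).
  exists (s ++ t) => //; rewrite cat_uniq us ut andbT /=.
  by apply/hasPn => k /ts.
move=> /(ub_le_sup supS.2); rewrite big_cat.
have -> (u v : R[i]) : complex.Re (u + v) = complex.Re u + complex.Re v.
  by case: u; case: v.
by move: hs => /=; lra.
Qed.

Lemma totally_bounded_summable (T : H -> H) : bounded_operator T ->
  basis_summable e T -> totally_bounded (T @` [set x | `|x| <= 1]).
Proof.
move=> bT hT; have [lT [M M0 hM]] := (bounded_operatorP T).1 bT.
apply: totally_bounded_approx => eps eps0.
have e2 : 0 < eps / 2 by rewrite divr_gt0.
have [s us hs] := basis_summable_tail e2 hT.
exists [set x | exists2 c : I -> R[i], forall k, `|c k| <= 1 &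
    x = \sum_(k <- s) c k *: T (e k)]; first exact: totally_bounded_lincomb.
move=> _ [x x1 <-].
have c1 k : `|dotp x (e k)| <= 1.
  by rewrite (le_trans (dotp_le _ _)) // (norm_basis he.1) mulr1.
exists (\sum_(k <- s) dotp x (e k) *: T (e k)); first by exists (fun k => dotp x (e k)).
have M1 : 0 < M + 1 by rewrite ltr_wpDl.
have [t0 ht0] := basis_proj_approx he.1 he.2 x (divr_gt0 e2 M1).
(* [t] depends on x, but the tail bound holds for every t disjoint from s, so the approximation by T
   P_s is uniform on the unit ball. *)
pose t := [seq k <- undup t0 | k \notin s].
have ut : uniq t by rewrite filter_uniq ?undup_uniq.
have : `|x - basis_proj e (s ++ t) x| < eps / 2 / (M + 1).
  apply: ht0; last first.
    by move=> k kt; rewrite mem_cat mem_filter mem_undup kt andbT orbN.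
  rewrite cat_uniq us ut andbT /=; apply/hasPn => k.
  by rewrite mem_filter => /andP[].
rewrite ltr_pdivlMr // mulrC => hx.
have <- : T (basis_proj e s x) = \sum_(k <- s) dotp x (e k) *: T (e k).
  by rewrite linear_op_sum //; apply: eq_bigr => k _; rewrite linear_opZ.
rewrite -linear_opB // -(subrKA (basis_proj e (s ++ t) x)) linear_opD //.
rewrite (le_lt_trans (ler_normD _ _)) // [eps]splitr ltr_leD //.
  apply: le_lt_trans hx; rewrite (le_trans (hM _)) //.
  by rewrite ler_wpM2r // lerDl.
rewrite /basis_proj big_cat /= addrAC subrr add0r linear_op_sum //.
apply: le_trans (hs t ut _); last by move=> k; rewrite mem_filter => /andP[].
apply: le_trans (ler_norm_sum _ _ _) _; apply: ler_sum => k _.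
by rewrite linear_opZ // normrZ ler_piMl.
Qed.

End Compactness.

(** Needed because [universal_norm] ranges over separable spaces. Finite combinations with
    coefficients in Q + iQ form the countable dense set. *)
Lemma orthonormal_basis_separable (R : realType) (H : hilbertType R[i])
    (I : countType) (e : I -> H) : orthonormal_basis e -> separable H.
Proof.
move=> [oe de].
pose f (s : seq ((rat * rat) * I)) : H :=
  \sum_(p <- s) Complex (ratr p.1.1 : R) (ratr p.1.2) *: e p.2.
exists (range f); split; first exact: sub_countable (card_image_le _ _) (countableP _).
apply: near_dense => x eps eps0.
have approx (s : seq (R[i] * I)) (d : R[i]) : 0 < d ->
    exists t, `|\sum_(p <- s) p.1 *: e p.2 - f t| < d.
  elim: s d => [|p s IH] d d0.
    by exists [::]; rewrite /f !big_nil subr0 normr0.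
  have d2 : 0 < d / 2 by rewrite divr_gt0.
  have [t ht] := IH _ d2; have [a [b hab]] := rat_complex_dense p.1 d2.
  exists (((a, b), p.2) :: t); rewrite /f !big_cons opprD addrACA -scalerBl.
  by rewrite (le_lt_trans (ler_normD _ _)) // [d]splitr ltrD // normrZ (norm_basis oe) mulr1.
have e2 : 0 < eps / 2 by rewrite divr_gt0.
have [_ [s ->] xs] := dense_near de x e2; have [t ht] := approx s _ e2.
exists (f t); first by exists t.
by rewrite -(subrKA (\sum_(p <- s) p.1 *: e p.2)) (le_lt_trans (ler_normD _ _)) // [eps]splitr ltrD.
Qed.

(** * Star representations and the universal norm *)

Section StarAlgebraTheory.
Variables (K : numClosedFieldType) (A : starAlgType K).
Implicit Types a b : A.

Lemma amulNl a b : (- a) ⋅ b = - (a ⋅ b).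
Proof. by rewrite -(scaleN1r a) amulZl scaleN1r. Qed.

Lemma amulNr a b : a ⋅ (- b) = - (a ⋅ b).
Proof. by rewrite -(scaleN1r b) amulZr scaleN1r. Qed.

Lemma starB a b : star (a - b) = star a - star b.
Proof. by rewrite starD -(scaleN1r b) starZ rmorphN rmorph1 scaleN1r. Qed.

Lemma star1 : star aone = aone :> A.
Proof.
have : star (aone ⋅ star aone) = aone ⋅ star aone :> A by rewrite starM starK.
by rewrite amul1l starK.
Qed.

End StarAlgebraTheory.

Section Representation.
Variables (K : numClosedFieldType) (A : starAlgType K) (H : hilbertType K).
Variables (pi : A -> H -> H).
Hypothesis hpi : star_representation pi.

Lemma rep0 x : pi 0 x = 0.
Proof.
by have := rep_linear hpi (-1) 0 0 x; rewrite !scaleN1r !addNr.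
Qed.

Lemma repD a b x : pi (a + b) x = pi a x + pi b x.
Proof. by have := rep_linear hpi 1 a b x; rewrite !scale1r. Qed.

Lemma repZ c a x : pi (c *: a) x = c *: pi a x.
Proof. by have := rep_linear hpi c a 0 x; rewrite rep0 !addr0. Qed.

Lemma repB a b x : pi (a - b) x = pi a x - pi b x.
Proof. by rewrite repD -scaleN1r repZ scaleN1r. Qed.

Lemma rep_sum (I : finType) (a : I -> A) x :
  pi (\sum_i a i) x = \sum_i pi (a i) x.
Proof. by apply: (big_morph (pi^~ x)) => [a1 a2|]; [exact: repD|exact: rep0]. Qed.

Lemma rep_star_l a x y : dotp (pi (star a) x) y = dotp x (pi a y).
Proof. by rewrite rep_star // starK. Qed.

Lemma rep_opB a x y : pi a (x - y) = pi a x - pi a y.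
Proof. by rewrite linear_opB //; have [] := rep_bounded hpi a. Qed.

(** From |a^* x|^2 = <x, a a^* x> <= |x| M |a^* x|, divided by |a^* x|. *)
Lemma norm_rep_star a (M : K) : 0 <= M -> (forall x, `|pi a x| <= M * `|x|) ->
  forall x, `|pi (star a) x| <= M * `|x|.
Proof.
move=> M0 h x; have [->|nz] := eqVneq (pi (star a) x) 0.
  by rewrite normr0 mulr_ge0.
have n0 : 0 < `|pi (star a) x| by rewrite normr_gt0.
rewrite -(ler_pM2l n0) -expr2 -dotp_norm rep_star_l.
have := le_trans (real_ler_norm _) (dotp_le x (pi a (pi (star a) x))).
rewrite -rep_star_l dotp_norm ger0_real ?exprn_ge0 // => /(_ isT) /le_trans; apply.
by rewrite mulrA [leRHS]mulrC ler_wpM2l // [leRHS]mulrC h.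
Qed.

End Representation.

Section UniversalNorm.
Variables (R : realType) (q : R) (n : nat).

(** Every element is the class of a formal expression, so the induction is on expressions. Each
    constructor is matched with its algebra operation by evaluating both in all models of the
    relations. *)
Lemma qsphere_ind (P : qsphere q n -> Prop) :
  (forall i, P (qsphere_gen q i)) -> P aone ->
  (forall a b, P a -> P b -> P (a + b)) ->
  (forall c a, P a -> P (c *: a)) ->
  (forall a b, P a -> P b -> P (a ⋅ b)) ->
  (forall a, P a -> P (star a)) -> forall a, P a.
Proof.
move=> hg h1 hD hZ hM hs a; rewrite -(qsphere_reprK a).
elim: (qsphere_repr a) => [i||t IHt u IHu|c t IHt|t IHt u IHu|t IHt].
- exact: hg.
- exact: h1.
- have -> : qsphere_class q (EAdd t u) = qsphere_class q t + qsphere_class q u.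
    by apply: qsphereP => B x hx; rewrite (qsphere_evalD hx) !(qsphere_eval_class _ hx).
  exact: hD.
- have -> : qsphere_class q (EScale c t) = c *: qsphere_class q t.
    by apply: qsphereP => B x hx; rewrite (qsphere_evalZ hx) !(qsphere_eval_class _ hx).
  exact: hZ.
- have -> : qsphere_class q (EMul t u) = qsphere_class q t ⋅ qsphere_class q u.
    by apply: qsphereP => B x hx; rewrite (qsphere_evalM hx) !(qsphere_eval_class _ hx).
  exact: hM.
- have -> : qsphere_class q (EStar t) = star (qsphere_class q t).
    by apply: qsphereP => B x hx; rewrite (qsphere_eval_star hx) !(qsphere_eval_class _ hx).
  exact: hs.
Qed.

Lemma rep_gen_contraction (H : hilbertType R[i]) (pi : qsphere q n -> H -> H) i x :
  star_representation pi -> `|pi (qsphere_gen q i) x| <= `|x|.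
Proof.
move=> hpi; rewrite -(@ler_pXn2r _ 2%N) ?nnegrE // -!dotp_norm.
have <- : \sum_j dotp (pi (qsphere_gen q j) x) (pi (qsphere_gen q j) x) = dotp x x.
  transitivity (dotp (pi aone x) x); last by rewrite rep1.
  rewrite -(sphere_sum (qsphere_gen_relations q n)) rep_sum //.
  by rewrite dotp_suml; apply: eq_bigr => j _; rewrite repM // rep_star_l.
by rewrite (bigD1 i) //= lerDl sumr_ge0.
Qed.

(** One M serves all representations, which bounds the set in [universal_norm]; on an unbounded set
    [sup] would be the default value 0. *)
Lemma rep_uniform_bound (a : qsphere q n) : exists2 M : R[i], 0 <= M &
  forall (H : hilbertType R[i]) (pi : qsphere q n -> H -> H),
    star_representation pi -> forall x, `|pi a x| <= M * `|x|.
Proof.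
elim/qsphere_ind: a => [i||a b [M M0 hM] [N N0 hN]|c a [M M0 hM]|a b [M M0 hM] [N N0 hN]|a [M M0 hM]].
- by exists 1 => // H pi hpi x; rewrite mul1r rep_gen_contraction.
- by exists 1 => // H pi hpi x; rewrite mul1r rep1.
- exists (M + N) => [|H pi hpi x]; first exact: addr_ge0.
  rewrite repD // mulrDl (le_trans (ler_normD _ _)) // lerD //; [exact: hM|exact: hN].
- exists (`|c| * M) => [|H pi hpi x]; first exact: mulr_ge0.
  by rewrite repZ // normrZ -mulrA ler_wpM2l // hM.
- exists (M * N) => [|H pi hpi x]; first exact: mulr_ge0.
  rewrite repM // (le_trans (hM _ _ hpi _)) // -mulrA ler_wpM2l //; exact: hN.
- by exists M => // H pi hpi x; apply: norm_rep_star => //; exact: hM.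
Qed.

Lemma operator_norm_ubound (H : hilbertType R[i]) (T : H -> H) (M : R[i]) :
  (forall x, `|T x| <= M * `|x|) -> 0 <= M ->
  ubound [set r : R | exists2 x : H, `|x| <= 1 & `|T x| = r%:C] (complex.Re M).
Proof.
move=> hM M0 r [x x1 Tx].
have : r%:C <= M by rewrite -Tx (le_trans (hM x)) // ler_piMr.
by rewrite lecE => /andP[].
Qed.

Lemma operator_norm_le (H : hilbertType R[i]) (T : H -> H) (M : R[i]) :
  (forall x, `|T x| <= M * `|x|) -> 0 <= M -> operator_norm T <= complex.Re M.
Proof.
move=> hM M0; apply: ge_sup; last exact: operator_norm_ubound.
exists 0, 0; rewrite ?normr0 //.
by apply/eqP; rewrite -normr_le0 normr_id (le_trans (hM 0)) // normr0 mulr0.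
Qed.

Lemma operator_normP (H : hilbertType R[i]) (T : H -> H) x :
  bounded_operator T -> `|T x| <= (operator_norm T)%:C * `|x|.
Proof.
move=> /bounded_operatorP[lT [M M0 hM]].
have [->|x0] := eqVneq x 0; first by rewrite linear_op0 // !normr0 mulr0.
have nx : 0 < `|x| by rewrite normr_gt0.
rewrite -ler_pdivrMr // mulrC -[(`|x|^-1)]ger0_norm ?invr_ge0 // -normrZ -linear_opZ //.
set y := _ *: x; have [r hr] : exists r : R, `|T y| = r%:C.
  by exists (complex.Re `|T y|); rewrite RRe_real // normr_real.
rewrite hr lecR; apply: ub_le_sup.
  by exists (complex.Re M); exact: operator_norm_ubound.
by exists y => //; rewrite /y normrZ normfV normr_id mulVf // gt_eqF.
Qed.

Lemma rep_le_universal_norm (H : hilbertType R[i]) (pi : qsphere q n -> H -> H) a x :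
  separable H -> star_representation pi ->
  `|pi a x| <= (universal_norm a)%:C * `|x|.
Proof.
move=> sH hpi; rewrite (le_trans (operator_normP _ (rep_bounded hpi a))) //.
rewrite ler_wpM2r // lecR; apply: ub_le_sup; last by exists H, pi.
have [M M0 hM] := rep_uniform_bound a; exists (complex.Re M) => _ [H' [pi' [_ hpi' ->]]].
by apply: operator_norm_le => // y; exact: hM.
Qed.

End UniversalNorm.

(** The C*-identity gives |b|^2 = |b^* b| <= |b^*| |b|; apply this to both a and a^*. *)
Lemma cstar_norm_star (K : numClosedFieldType) (C : cstarAlgType K) (a : C) :
  `|star a| = `|a|.
Proof.
have le_star (b : C) : `|b| <= `|star b|.
  have [->|b0] := eqVneq b 0; first by rewrite normr0.
  have nb : 0 < `|b| by rewrite normr_gt0.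
  by rewrite -(ler_pM2r nb) -expr2 -cstar_identity cstar_normM.
by apply/le_anti; rewrite le_star -{2}(starK a) le_star.
Qed.

(** * Extension of a representation to the completion *)

Section Extension.
Variables (R : realType) (A : starAlgType R[i]) (C : cstarAlgType R[i]) (iota : A -> C).
Hypothesis hC : universal_completion iota.
Variables (H : hilbertType R[i]) (psi : A -> H -> H).
Hypothesis hpsi : star_representation psi.
Hypothesis psi_le : forall a x, `|psi a x| <= `|iota a| * `|x|.

Lemma completion_approx (c : C) (eps : R[i]) : 0 < eps ->
  exists a, `|iota a - c| <= eps.
Proof.
move=> eps0; have [_ [a _ <-] ca] := dense_near (completion_dense hC) c eps0.
by exists a; rewrite distrC ltW.
Qed.

(** Psi c x is the limit of psi a x as iota a tends to c; [psi_le] makes it independent of the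
    chosen a even when [iota] has a kernel. The algebraic laws then follow from uniqueness of this
    limit, in the form [Psi_eq]. *)
Lemma extension_to_completion : exists Psi : C -> H -> H, extends_to_completion iota psi Psi.
Proof.
have [iL i1 iM iS] := completion_morphism hC.
have iB a b : iota (a - b) = iota a - iota b.
  by rewrite -scaleN1r addrC iL scaleN1r addrC.
have psiB a b x : `|psi a x - psi b x| <= `|iota a - iota b| * `|x|.
  by rewrite -repB // -iB psi_le.
have /choice [Psi' hPsi'] (p : C * H) :
    exists y, forall a, `|psi a p.2 - y| <= `|iota a - p.1| * `|p.2|.
  apply: (@approx_limit _ H A (fun a => psi a p.2) (fun a => `|iota a - p.1| * `|p.2|)).
    move=> eps eps0; have x1 : 0 < `|p.2| + 1 by rewrite ltr_wpDl.
    have [_ [a _ <-] ca] := dense_near (completion_dense hC) p.1 (divr_gt0 eps0 x1).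
    exists a; move: ca; rewrite ltr_pdivlMr // distrC; apply: le_lt_trans.
    by rewrite ler_wpM2l // lerDl.
  move=> a b; rewrite (le_trans (psiB _ _ _)) // -mulrDl ler_wpM2r //.
  by rewrite -[iota a - iota b](subrKA p.1) [(`|iota b - _|)]distrC ler_normD.
pose Psi c x := Psi' (c, x).
have hPsi c x a : `|psi a x - Psi c x| <= `|iota a - c| * `|x| by exact: hPsi' (c, x) a.
have Psi_eq c x y (M N : R[i]) : 0 <= M -> 0 <= N ->
    (forall e, 0 < e -> exists2 a, `|iota a - c| <= N * e & `|psi a x - y| <= M * e) ->
    Psi c x = y.
  move=> M0 N0 h; apply/eqP; rewrite -subr_eq0; apply/eqP.
  apply: (@normr_le0_eps _ _ _ (N * `|x| + M)) => [|e e0].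
    by rewrite addr_ge0 // mulr_ge0.
  have [a ha hy] := h e e0.
  rewrite -(subrKA (psi a x)) (le_trans (ler_normD _ _)) // mulrDl lerD // distrC.
  by rewrite (le_trans (hPsi _ _ _)) // mulrAC ler_wpM2r.
have PsiE a x : Psi (iota a) x = psi a x.
  apply: (Psi_eq _ _ _ 0 0) => // e e0.
  by exists a; rewrite subrr normr0 mul0r.
have Psi_le c x : `|Psi c x| <= `|c| * `|x|.
  apply: le_addgt0 => e e0.
  (* Two errors of size |iota a - c| |x| occur: one replaces |iota a| by |c|, the other psi a x by
     Psi c x. *)
  have x1 : 0 < 2 * (`|x| + 1) by rewrite mulr_gt0 // ltr_wpDl.
  have [a ha] := completion_approx c (divr_gt0 e0 x1).
  have -> : Psi c x = psi a x + (Psi c x - psi a x) by rewrite addrC subrK.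
  rewrite (le_trans (ler_normD _ _)) // distrC.
  rewrite (le_trans (lerD (psi_le _ _) (hPsi _ _ _))) //.
  have iac : `|iota a| <= `|c| + `|iota a - c|.
    by rewrite -{1}(subrK c (iota a)) addrC ler_normD.
  rewrite (le_trans (lerD (ler_wpM2r (normr_ge0 x) iac) (lexx _))) //.
  rewrite mulrDl -addrA lerD2l -mulrDl -mulr2n -mulr_natl.
  move: ha; rewrite ler_pdivlMr // => /(le_trans _); apply.
  by rewrite mulrAC [leRHS]mulrC ler_wpM2r // ler_wpM2l // lerDl.
have Psi_lin c : linear (Psi c).
  move=> k x y; apply: (Psi_eq _ _ _ (`|k| * `|x| + `|y|) 1) => // e e0.
  have [a ha] := completion_approx c e0; exists a; first by rewrite mul1r.
  have [la _] := rep_bounded hpsi a.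
  rewrite la opprD addrACA -scalerBr (le_trans (ler_normD _ _)) // mulrDl lerD //.
    rewrite normrZ -mulrA ler_wpM2l // (le_trans (hPsi _ _ _)) // mulrC.
    by rewrite ler_wpM2l.
  by rewrite (le_trans (hPsi _ _ _)) // mulrC ler_wpM2l.
have rPsi : star_representation Psi.
  split.
  - by move=> c; apply/bounded_operatorP; split => //; exists `|c|.
  - move=> k c d x; apply: (Psi_eq _ _ _ ((`|k| + 1) * `|x|) (`|k| + 1)).
    + by rewrite mulr_ge0 // addr_ge0.
    + by rewrite addr_ge0.
    move=> e e0; have [a ha] := completion_approx c e0.
    have [b hb] := completion_approx d e0; exists (k *: a + b).
      rewrite iL opprD addrACA -scalerBr (le_trans (ler_normD _ _)) //.
      by rewrite mulrDl lerD ?mul1r // normrZ ler_wpM2l.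
    rewrite (rep_linear hpsi) opprD addrACA -scalerBr (le_trans (ler_normD _ _)) //.
    rewrite -mulrA mulrDl mul1r lerD //.
      rewrite normrZ ler_wpM2l // (le_trans (hPsi _ _ _)) // mulrC.
      by rewrite ler_wpM2l.
    by rewrite (le_trans (hPsi _ _ _)) // mulrC ler_wpM2l.
  - by move=> x; rewrite -i1 PsiE rep1.
  - move=> c d x; apply: (Psi_eq _ _ _ (`|x| + `|Psi d x|) (1 + `|d|)).
    + by rewrite addr_ge0.
    + by rewrite addr_ge0.
    move=> e e0; have [a ha] := completion_approx c e0.
    (* [b] is chosen after [a], because iota a (iota b - d) is small only relative to |iota a|. *)
    have a1 : 0 < `|iota a| + 1 by rewrite ltr_wpDl.
    have [b] := completion_approx d (divr_gt0 e0 a1).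
    rewrite ler_pdivlMr // => hb.
    have hb' : `|iota a| * `|iota b - d| <= e.
      by apply: le_trans hb; rewrite mulrC ler_wpM2l // lerDl.
    exists (a ⋅ b).
      have -> : iota (a ⋅ b) - c ⋅ d = iota a ⋅ (iota b - d) + (iota a - c) ⋅ d.
        by rewrite iM amulDr amulDl amulNr amulNl addrA subrK.
      rewrite (le_trans (ler_normD _ _)) // mulrDl mul1r lerD //.
        by rewrite (le_trans (cstar_normM _ _)).
      by rewrite (le_trans (cstar_normM _ _)) // mulrC ler_wpM2l.
    have -> : psi (a ⋅ b) x - Psi c (Psi d x) =
        psi a (psi b x - Psi d x) + (psi a (Psi d x) - Psi c (Psi d x)).
      by rewrite repM // rep_opB // subrKA.
    rewrite (le_trans (ler_normD _ _)) // mulrDl lerD //.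
      rewrite (le_trans (psi_le _ _)) // (le_trans (ler_wpM2l _ (hPsi _ _ _))) //.
      by rewrite mulrA mulrC ler_wpM2l.
    by rewrite (le_trans (hPsi _ _ _)) // mulrC ler_wpM2l.
  - move=> c x y; apply/eqP; rewrite -subr_eq0; apply/eqP.
    apply: (@normr_le0_eps _ R[i]^o _ (2 * (`|x| * `|y|))); first by rewrite !mulr_ge0.
    move=> e e0; have [a ha] := completion_approx c e0.
    rewrite -(subrKA (dotp (psi a x) y)) {2}(rep_star hpsi) -dotpBl -dotpBr.
    rewrite (le_trans (ler_normD _ _)) // -mulrA mulr_natl mulr2n lerD //.
      rewrite (le_trans (dotp_le _ _)) // mulrAC ler_wpM2r //.
      by rewrite distrC (le_trans (hPsi _ _ _)) // mulrC ler_wpM2l.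
    rewrite (le_trans (dotp_le _ _)) // -mulrA ler_wpM2l //.
    rewrite (le_trans (hPsi _ _ _)) // mulrC ler_wpM2l // iS.
    by rewrite -starB cstar_norm_star.
by exists Psi; split.
Qed.

End Extension.

(** * Weighted shifts *)

Section BoundedOperators.
Variables (K : numClosedFieldType) (H : hilbertType K).
Implicit Types S T F : H -> H.

Lemma bounded_operator_comp S T :
  bounded_operator S -> bounded_operator T -> bounded_operator (S \o T).
Proof.
move=> [lS cS] [lT cT]; split; first by move=> c x y; rewrite /= lT lS.
by move=> x; apply: continuous_comp; [exact: cT|exact: cS].
Qed.

Lemma bounded_operatorB S T : bounded_operator S -> bounded_operator T ->
  bounded_operator (fun x => S x - T x).
Proof.
move=> [lS cS] [lT cT]; split; last by move=> x; apply: cvgB; [exact: cS|exact: cT].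
by move=> c x y; rewrite lS lT opprD addrACA scalerBr.
Qed.

Lemma bounded_operatorN T : bounded_operator T -> bounded_operator (fun x => - T x).
Proof.
move=> [lT cT]; split; last by move=> x; apply: cvgN; exact: cT.
by move=> c x y; rewrite lT opprD scalerN.
Qed.

Lemma bounded_commutator F T :
  bounded_operator F -> bounded_operator T -> bounded_operator (commutator F T).
Proof.
move=> bF bT; apply: bounded_operatorB.
  exact: (bounded_operator_comp bF bT).
exact: (bounded_operator_comp bT bF).
Qed.

Lemma commutator_adjoint F T T' : selfadjoint F ->
  (forall x y, dotp (T x) y = dotp x (T' y)) ->
  forall x y, dotp (commutator F T x) y = dotp x (- commutator F T' y).
Proof.
move=> sF adj x y.
by rewrite /commutator dotpBl sF !adj sF opprB dotpBr.
Qed.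

End BoundedOperators.

Section WeightedShift.
Variables (K : numClosedFieldType) (H : hilbertType K) (I : choiceType) (e : I -> H).
Hypothesis he : orthonormal_basis e.

(** Density extends the identity one argument at a time: [half] treats the first, and conjugation
    turns the second into a first. *)
Lemma adjoint_on_basis (S T : H -> H) : bounded_operator S -> bounded_operator T ->
  (forall k l, dotp (S (e k)) (e l) = dotp (e k) (T (e l))) ->
  forall x y, dotp (S x) y = dotp x (T y).
Proof.
have half (B : H -> H) v w : bounded_operator B ->
    (forall k, dotp (B (e k)) v = dotp (e k) w) -> forall x, dotp (B x) v = dotp x w.
  move=> /bounded_operatorP[lB [M M0 hM]] h; apply: (basis_ind he.2).
  - by rewrite linear_op0 // !dotp0l.
  - by move=> c k y IH; rewrite lB !dotpDl !dotpZl IH h.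
  move=> x hx; apply/eqP; rewrite -subr_eq0; apply/eqP.
  apply: (@normr_le0_eps _ K^o _ (M * `|v| + `|w|)) => [|d d0].
    by rewrite addr_ge0 // mulr_ge0.
  have [y hy /ltW xy] := hx _ d0.
  rewrite -(subrKA (dotp (B y) v)) -dotpBl -linear_opB // hy -dotpBl.
  rewrite (le_trans (ler_normD _ _)) // mulrDl lerD // (le_trans (dotp_le _ _)) //.
    by rewrite mulrAC ler_wpM2r // (le_trans (hM _)) // ler_wpM2l.
  by rewrite mulrC ler_wpM2l // distrC.
move=> bS bT hST x y; rewrite dotpC [RHS]dotpC; congr (_^*).
rewrite -(half T x (S x) bT) // => l; rewrite dotpC [RHS]dotpC; congr (_^*).
by rewrite (half S (e l) (T (e l)) bS).
Qed.

(** Injectivity is asked only on the support of the weight: the lowering shift [decr] sends both 0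
    and 1 to 0, and its weight vanishes at 0. *)
Definition weighted_shift (T : H -> H) (w : I -> K) (sigma : I -> I) : Prop :=
  (forall l, T (e l) = w l *: e (sigma l)) /\
  forall l m, w l != 0 -> w m != 0 -> sigma l = sigma m -> l = m.

Lemma sum_partial_injection (f g : I -> K) (sigma : I -> I) (M C : K) :
  0 <= M -> (forall l, f l != 0 -> f l <= M * g (sigma l)) ->
  (forall l m, f l != 0 -> f m != 0 -> sigma l = sigma m -> l = m) ->
  (forall s, uniq s -> \sum_(l <- s) g l <= C) ->
  forall s, uniq s -> \sum_(l <- s) f l <= M * C.
Proof.
move=> M0 fg inj hC s us.
rewrite (bigID (fun l => f l == 0)) /= big1 ?add0r => [|l /eqP //].
have ut : uniq [seq sigma l | l <- s & f l != 0].
  rewrite map_inj_in_uniq ?filter_uniq // => l m.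
  by rewrite !mem_filter => /andP[? _] /andP[? _]; exact: inj.
apply: le_trans (ler_wpM2l M0 (hC _ ut)).
rewrite mulr_sumr big_map big_filter; apply: ler_sum => l; exact: fg.
Qed.

Lemma norm_weighted_shift T w sigma l : weighted_shift T w sigma -> `|T (e l)| = `|w l|.
Proof. by move=> [hT _]; rewrite hT normrZ (norm_basis he.1) mulr1. Qed.

Lemma basis_summable_shift S T w sigma : linear S -> bounded_operator T ->
  weighted_shift T w sigma -> basis_summable e S -> basis_summable e (fun x => S (T x)).
Proof.
move=> lS /bounded_operatorP[_ [M M0 hM]] wT [C hC]; exists (M * C).
have STe l : `|S (T (e l))| = `|w l| * `|S (e (sigma l))|.
  by rewrite wT.1 linear_opZ // normrZ.
have w0 l : `|S (T (e l))| != 0 -> w l != 0.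
  by rewrite STe; apply: contraNneq => ->; rewrite normr0 mul0r.
apply: (sum_partial_injection (sigma := sigma)) hC => // [l _|l m /w0 wl /w0 wm].
  rewrite STe ler_wpM2r // -(norm_weighted_shift l wT).
  by rewrite (le_trans (hM _)) // (norm_basis he.1) mulr1.
exact: wT.2.
Qed.

(** The adjoint shifts backwards along [sigma] with conjugate weights, and kills the basis vectors
    that are not reached with nonzero weight. *)
Lemma weighted_shift_adjoint T T' w sigma :
  weighted_shift T w sigma -> (forall x y, dotp (T x) y = dotp x (T' y)) ->
  exists w' tau, weighted_shift T' w' tau /\
    forall l, w' l != 0 -> sigma (tau l) = l /\ `|w' l| = `|w (tau l)|.
Proof.
move=> [hT inj] adj.
have T'e l m : dotp (T' (e l)) (e m) = (w m * (sigma m == l)%:R)^*.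
  by rewrite dotpC -adj hT dotpZl he.1.
have /choice [p hp] l : exists p : K * I, T' (e l) = p.1 *: e p.2 /\
    (p.1 != 0 -> sigma p.2 = l /\ `|p.1| = `|w p.2|).
  have [[m [wm <-]]|no] := pselect (exists m, w m != 0 /\ sigma m = l).
    exists ((w m)^*, m); split; last by rewrite norm_conjC.
    apply: (dotp_basis_eq he.2) => k; rewrite T'e dotpZl he.1 rmorphM rmorph_nat.
    have [->|mk] := eqVneq m k; first by rewrite eqxx.
    have [->|wk] := eqVneq (w k) 0; first by rewrite rmorph0 mul0r mulr0.
    rewrite (_ : (sigma k == sigma m) = false) ?mulr0 //.
    by apply: contra_neqF mk => /eqP /inj ->.
  (* The weight is 0, so the target index l is a dummy. *)
  exists (0, l); rewrite eqxx; split => //.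
  apply: (dotp_basis_eq he.2) => k; rewrite T'e scale0r dotp0l.
  have [->|wk] := eqVneq (w k) 0; first by rewrite mul0r rmorph0.
  have [kl|] := eqVneq (sigma k) l; last by rewrite mulr0 rmorph0.
  by case: no; exists k.
exists (fun l => (p l).1), (fun l => (p l).2); split; last by move=> l; exact: (hp l).2.
split=> [l|l m wl wm lm]; first exact: (hp l).1.
by rewrite -((hp l).2 wl).1 lm ((hp m).2 wm).1.
Qed.

Lemma basis_summable_shift_adjoint T T' w sigma :
  weighted_shift T w sigma -> (forall x y, dotp (T x) y = dotp x (T' y)) ->
  basis_summable e T -> basis_summable e T'.
Proof.
move=> wT adj [C hC]; have [w' [tau [wT' h]]] := weighted_shift_adjoint wT adj.
exists (1 * C); apply: (sum_partial_injection (sigma := tau)) hC => // [l|l m];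
  rewrite !(norm_weighted_shift _ wT') !normr_eq0.
  by move=> /h[_ ->]; rewrite (norm_weighted_shift _ wT) mul1r.
exact: wT'.2.
Qed.

Section Diagonal.
Variables (F : H -> H) (chi : I -> K).
Hypothesis bF : bounded_operator F.
Hypothesis Fe : forall k, F (e k) = chi k *: e k.

Lemma diagonal_selfadjoint : (forall k, (chi k)^* = chi k) -> selfadjoint F.
Proof.
move=> chiR; apply: adjoint_on_basis => // k l.
by rewrite !Fe dotpZl dotpZr chiR he.1; case: eqVneq => [->|]; rewrite ?mulr0.
Qed.

Lemma diagonal_square : (forall k, chi k ^+ 2 = 1) -> forall x, F (F x) = x.
Proof.
move=> chi2; have [lF _] := bF.
apply: (bounded_operator_basis_eq he.2 (S := F \o F) (T := id)) => [||k].
- exact: bounded_operator_comp.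
- by split => // x; exact: cvg_id.
by rewrite /= !Fe linear_opZ // Fe scalerA -expr2 chi2 scale1r.
Qed.

Lemma commutator_weighted_shift T w sigma : linear T -> weighted_shift T w sigma ->
  weighted_shift (commutator F T) (fun l => (chi (sigma l) - chi l) * w l) sigma.
Proof.
move=> lT [hT inj]; have [lF _] := bF; split=> [l|l m].
  rewrite /commutator Fe !hT linear_opZ // [T _]linear_opZ // hT Fe !scalerA -scalerBl.
  by congr (_ *: _); ring.
by rewrite !mulf_eq0 !negb_or => /andP[_ wl] /andP[_ wm]; exact: inj.
Qed.

Lemma commutator_summable_adjoint T T' w sigma : (forall k, (chi k)^* = chi k) ->
  linear T -> weighted_shift T w sigma -> (forall x y, dotp (T x) y = dotp x (T' y)) ->
  basis_summable e (commutator F T) -> basis_summable e (commutator F T').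
Proof.
move=> chiR lT wT adj hT.
have := basis_summable_shift_adjoint (commutator_weighted_shift lT wT)
  (commutator_adjoint (diagonal_selfadjoint chiR) adj) hT.
by move=> [C hC]; exists C => s us; under eq_bigr => k _ do rewrite -normrN; exact: hC.
Qed.

End Diagonal.
End WeightedShift.

(** * Commutators on the quantum sphere *)

(** A finite family of multi-indices fits into a box {0, ..., N}^n, over which the sum of r^|k|
    factors into n truncated geometric series. *)
Lemma sum_geometric_le (R : realType) (r : R) (n : nat) : 0 <= r < 1 ->
  forall s : seq {ffun 'I_n -> nat}, uniq s ->
  \sum_(k <- s) r ^+ (\sum_(l < n) k l)%N <= (1 - r)^-1 ^+ n.
Proof.
move=> /andP[r0 r1] s us.
pose N := (\max_(k <- s) \max_(l < n) k l)%N.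
have hN k l : k \in s -> (k l < N.+1)%N.
  move=> ks; rewrite ltnS (leq_trans (leq_bigmax l)) //.
  exact: (@leq_bigmax_seq _ s xpredT (fun k : {ffun 'I_n -> nat} => \max_(l < n) k l)%N k ks).
pose h (k : {ffun 'I_n -> nat}) : {ffun 'I_n -> 'I_N.+1} := [ffun l => inord (k l)].
have hE k l : k \in s -> h k l = k l :> nat by move=> ks; rewrite ffunE inordK ?hN.
have uh : uniq (map h s).
  rewrite map_inj_in_uniq // => k k' ks k's hk; apply/ffunP => l.
  by rewrite -(hE k l ks) hk hE.
have -> : \sum_(k <- s) r ^+ (\sum_(l < n) k l)%N =
    \sum_(f <- map h s) \prod_(l < n) r ^+ f l.
  rewrite big_map !big_seq; apply: eq_bigr => k ks.
  by rewrite -expr_sum; congr (_ ^+ _); apply: eq_bigr => l _; rewrite hE.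
have geo : \sum_(j < N.+1) r ^+ j <= (1 - r)^-1.
  have r1' : 0 < 1 - r by rewrite subr_gt0.
  rewrite -[leRHS]mul1r ler_pdivlMr // mulrC -opprB mulNr -subrX1 opprB gerBl.
  by rewrite exprn_ge0.
apply: (@le_trans _ _ (\sum_(f : {ffun 'I_n -> 'I_N.+1}) \prod_(l < n) r ^+ f l)).
  rewrite big_uniq //= [leRHS](bigID (fun f => f \in map h s)) /= lerDl.
  by apply: sumr_ge0 => f _; apply: prodr_ge0 => l _; rewrite exprn_ge0.
rewrite -(bigA_distr_bigA (fun (_ : 'I_n) (j : 'I_N.+1) => r ^+ j)) prodr_const card_ord.
rewrite lerXn2r ?nnegrE ?invr_ge0 ?subr_ge0 ?(ltW r1) //.
by apply: sumr_ge0 => j _; rewrite exprn_ge0.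
Qed.

Section Commutators.
Variables (K : numClosedFieldType) (H : hilbertType K) (I : choiceType) (e : I -> H).
Hypothesis he : orthonormal_basis e.
Variables (A : starAlgType K) (psi : A -> H -> H).
Hypothesis hpsi : star_representation psi.
Variables (F : H -> H).
Hypothesis bF : bounded_operator F.

(* Right multiplication by psi a does not preserve [basis_summable] for an
   arbitrary bounded psi a, so it is carried along in the induction. *)
Definition summable_commutator (a : A) : Prop :=
  basis_summable e (commutator F (psi a)) /\
  forall S, linear S -> basis_summable e S -> basis_summable e (fun x => S (psi a x)).

Lemma summable_commutator1 : summable_commutator aone.
Proof.
split=> [|S lS]; last by apply: basis_summable_eq => x; rewrite rep1.
exists 0 => s _; rewrite big1 // => k _.
by rewrite /commutator !rep1 // subrr normr0.
Qed.

Lemma summable_commutatorD a b :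
  summable_commutator a -> summable_commutator b -> summable_commutator (a + b).
Proof.
move=> [a1 a2] [b1 b2]; have [lF _] := bF; split=> [|S lS hS].
  apply: basis_summable_eq (basis_summableD a1 b1) => x.
  by rewrite /commutator !repD // (linear_opD _ _ lF) opprD addrACA.
apply: basis_summable_eq (basis_summableD (a2 S lS hS) (b2 S lS hS)) => x.
by rewrite repD // linear_opD.
Qed.

Lemma summable_commutatorZ c a : summable_commutator a -> summable_commutator (c *: a).
Proof.
have bZ : bounded_operator (fun x : H => c *: x).
  apply/bounded_operatorP; split; first by move=> d x y; rewrite scalerDr !scalerA mulrC.
  by exists `|c| => // x; rewrite normrZ.
move=> [a1 a2]; have [lF _] := bF; split=> [|S lS hS].
  apply: basis_summable_eq (basis_summable_compl bZ a1) => x.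
  by rewrite /commutator !repZ // (linear_opZ _ _ lF) scalerBr.
apply: basis_summable_eq (basis_summable_compl bZ (a2 S lS hS)) => x.
by rewrite repZ // linear_opZ.
Qed.

(** In [F, ab] = [F, a] b + a [F, b], the first term uses the right-multiplication clause of b with
    S = [F, psi a]; the second is a left multiplication. *)
Lemma summable_commutatorM a b :
  summable_commutator a -> summable_commutator b -> summable_commutator (a ⋅ b).
Proof.
move=> [a1 a2] [b1 b2]; have [la _] := rep_bounded hpsi a; split=> [|S lS hS].
  have lFa : linear (commutator F (psi a)).
    by have [] := bounded_commutator bF (rep_bounded hpsi a).
  apply: basis_summable_eq (basis_summableD (b2 _ lFa a1)
    (basis_summable_compl (rep_bounded hpsi a) b1)) => x.
  by rewrite /commutator !repM // (linear_opB _ _ la) subrKA.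
apply: basis_summable_eq (b2 _ _ (a2 S lS hS)) => [x|c x y]; first by rewrite repM.
by rewrite la lS.
Qed.

Lemma summable_commutator_shift a w sigma (chi : I -> K) :
  (forall k, F (e k) = chi k *: e k) -> (forall k, (chi k)^* = chi k) ->
  weighted_shift e (psi a) w sigma -> basis_summable e (commutator F (psi a)) ->
  summable_commutator a /\ summable_commutator (star a).
Proof.
move=> Fe chiR wa ha; have [la _] := rep_bounded hpsi a.
have adj := rep_star hpsi a; split; split=> //.
- move=> S lS hS; exact: (basis_summable_shift he lS (rep_bounded hpsi a) wa).
- exact: (commutator_summable_adjoint he bF Fe chiR la wa adj ha).
have [w' [tau [wa' _]]] := weighted_shift_adjoint he wa adj.
move=> S lS hS; exact: (basis_summable_shift he lS (rep_bounded hpsi (star a)) wa').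
Qed.

End Commutators.

Section QuantumSphereModule.
Variables (R : realType) (q : R) (n : nat).
Hypothesis hq : 1 < `|q|.
Local Notation I := (int * {ffun 'I_n -> nat})%type.
Variables (H : hilbertType R[i]) (e : I -> H).
Hypothesis he : orthonormal_basis e.
Variables (psi : qsphere q n -> H -> H).
Hypothesis hpsi : star_representation psi.
Hypothesis hpsi1 : forall (k0 : int) (k : {ffun 'I_n -> nat}),
  psi (qsphere_gen q ord0) (e (k0, k)) =
  (q ^- (\sum_(l < n) k l)%N)%:C *: e (k0 + 1, k).
Hypothesis hpsiS : forall (j : 'I_n) (k0 : int) (k : {ffun 'I_n -> nat}),
  psi (qsphere_gen q (lift ord0 j)) (e (k0, k)) =
  (Num.sqrt (1 - q ^- (2 * k j)%N)
     * q ^- (\sum_(l < n | (j < l)%N) k l)%N)%:C *: e (k0, decr j k).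
Variables (F : H -> H).
Hypothesis hF : bounded_operator F.
Hypothesis hFe : forall (k0 : int) (k : {ffun 'I_n -> nat}),
  F (e (k0, k)) = chi R k0 *: e (k0, k).

Let Fe (p : I) : F (e p) = chi R p.1 *: e p.
Proof. by case: p => k0 k; rewrite hFe. Qed.

Lemma chi_conj (m : int) : (chi R m)^* = chi R m.
Proof. by rewrite /chi; case: ifP; rewrite ?rmorphN rmorph1. Qed.

Lemma chi_square (m : int) : chi R m ^+ 2 = 1.
Proof. by rewrite /chi; case: ifP; rewrite ?sqrrN expr1n. Qed.

(** Since chi(0) = -1, the only sign change is from 0 to 1; this confines [F, x_1] to k_0 = 0. *)
Lemma chi_jump (m : int) : chi R (m + 1) - chi R m = if m == 0 then 2 else 0.
Proof.
rewrite /chi; have [->|m0] := eqVneq m 0; first by rewrite add0r ltr01 ltxx opprK.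
have -> : (0 < m + 1) = (0 < m) by rewrite ltzD1 le_eqVlt eq_sym (negPf m0).
by rewrite subrr.
Qed.

Lemma weighted_shift_gen0 : weighted_shift e (psi (qsphere_gen q ord0))
  (fun p => (q ^- (\sum_(l < n) p.2 l)%N)%:C) (fun p => (p.1 + 1, p.2)).
Proof.
split=> [[k0 k]|[k0 k] [m0 m] _ _ /= [/addIr -> ->]] //; exact: hpsi1.
Qed.

Lemma weighted_shift_genS (j : 'I_n) :
  weighted_shift e (psi (qsphere_gen q (lift ord0 j)))
    (fun p => (Num.sqrt (1 - q ^- (2 * p.2 j)%N)
       * q ^- (\sum_(l < n | (j < l)%N) p.2 l)%N)%:C) (fun p => (p.1, decr j p.2)).
Proof.
(* A nonzero weight excludes k_j = 0, where the root vanishes; on positive entries the truncated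
   predecessor in [decr] is injective. *)
have pos (k : {ffun 'I_n -> nat}) : (Num.sqrt (1 - q ^- (2 * k j)%N)
    * q ^- (\sum_(l < n | (j < l)%N) k l)%N)%:C != 0 :> R[i] -> (0 < k j)%N.
  by rewrite lt0n; apply: contraNneq => ->; rewrite muln0 expr0 invr1 subrr sqrtr0 mul0r.
split=> [[k0 k]|[k0 k] [m0 m] /pos kj /pos mj /= [-> /ffunP km]]; first exact: hpsiS.
congr (_, _); apply/ffunP => l; have := km l; rewrite !ffunE.
by have [->|_] := eqVneq l j; rewrite ?subn0 // !subn1 -{2}(prednK kj) -{2}(prednK mj) => ->.
Qed.

Lemma basis_summable_commutator_gen0 :
  basis_summable e (commutator F (psi (qsphere_gen q ord0))).
Proof.
have [lx _] := rep_bounded hpsi (qsphere_gen q ord0).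
have wx := commutator_weighted_shift hF Fe lx weighted_shift_gen0.
(* The sign of q is free, so the series is geometric in |q|^-1. *)
set r := `|q|^-1.
have r01 : 0 <= r < 1 by rewrite invr_ge0 normr_ge0 invf_lt1 // (lt_trans ltr01).
exists (2 * (1 - r)^-1 ^+ n)%:C => s us.
have -> : \sum_(p <- s) `|commutator F (psi (qsphere_gen q ord0)) (e p)| =
    (\sum_(p <- s | p.1 == 0) 2 * r ^+ (\sum_(l < n) p.2 l)%N)%:C.
  rewrite rmorph_sum [RHS]big_mkcond; apply: eq_bigr => p _.
  rewrite (norm_weighted_shift he _ wx) /= chi_jump; case: eqP => _; last by rewrite mul0r normr0.
  rewrite normrM normr_nat rmorphM rmorph_nat normc_def /= expr0n addr0 sqrtr_sqr.
  by rewrite normfV normrX exprVn.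
rewrite lecR -mulr_sumr ler_pM2l // -big_filter.
have -> : \sum_(p <- [seq p <- s | p.1 == 0]) r ^+ (\sum_(l < n) p.2 l)%N =
    \sum_(k <- map snd [seq p <- s | p.1 == 0]) r ^+ (\sum_(l < n) k l)%N.
  by rewrite big_map.
apply: sum_geometric_le => //; rewrite map_inj_in_uniq ?filter_uniq //.
move=> [k0 k] [m0 m]; rewrite !mem_filter /=.
by move=> /andP[/eqP -> _] /andP[/eqP -> _] ->.
Qed.

Lemma basis_summable_commutator_genS (j : 'I_n) :
  basis_summable e (commutator F (psi (qsphere_gen q (lift ord0 j)))).
Proof.
have [lx _] := rep_bounded hpsi (qsphere_gen q (lift ord0 j)).
have wx := commutator_weighted_shift hF Fe lx (weighted_shift_genS j).
exists 0 => s us; rewrite big1 // => p _.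
by rewrite (norm_weighted_shift he _ wx) /= subrr mul0r normr0.
Qed.

Lemma basis_summable_commutator a : basis_summable e (commutator F (psi a)).
Proof.
(* The adjoint is carried along because the property does not pass from a to a^* in general; the
   star case then only swaps the two halves. *)
suff [[]] : summable_commutator e psi F a /\ summable_commutator e psi F (star a) by [].
elim/qsphere_ind: a => [i||a b [? ?] [? ?]|c a [? ?]|a b [? ?] [? ?]|a [? ?]].
- have [j ->|->] := unliftP ord0 i.
    apply: (summable_commutator_shift he hpsi hF Fe _ (weighted_shift_genS j)).
      by move=> k; exact: chi_conj.
    exact: basis_summable_commutator_genS.
  apply: (summable_commutator_shift he hpsi hF Fe _ weighted_shift_gen0).
    by move=> k; exact: chi_conj.
  exact: basis_summable_commutator_gen0.
- by rewrite star1; split; exact: summable_commutator1.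
- by rewrite starD; split; exact: summable_commutatorD.
- by rewrite starZ; split; exact: summable_commutatorZ.
- by rewrite starM; split; exact: summable_commutatorM.
- by rewrite starK.
Qed.

Lemma sign_selfadjoint : selfadjoint F.
Proof. by apply: (diagonal_selfadjoint he hF Fe) => k; exact: chi_conj. Qed.

Lemma trace_class_commutator a : trace_class (commutator F (psi a)).
Proof.
apply: (trace_class_of_summable he _ _ (commutator_adjoint sign_selfadjoint
  (rep_star hpsi a))); last exact: basis_summable_commutator.
  exact: bounded_commutator (rep_bounded hpsi a).
apply: bounded_operatorN; exact: bounded_commutator (rep_bounded hpsi (star a)).
Qed.

Lemma compact_commutator (C : cstarAlgType R[i]) (iota : qsphere q n -> C) Psi c :
  universal_completion iota -> extends_to_completion iota psi Psi ->
  compact_operator (commutator F (Psi c)).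
Proof.
move=> hC hPsi; have rPsi := extension_rep hPsi.
have [lF [M M0 hM]] := (bounded_operatorP F).1 hF.
split; first exact: bounded_commutator (rep_bounded rPsi c).
apply: totally_bounded_precompact; apply: totally_bounded_approx => eps eps0.
(* With M a bound for F, the commutator with Psi (c - iota a) is at most 2 M |c - iota a| on the
   unit ball; the added 1 keeps the divisor positive. *)
have M1 : 0 < M * 2 + 1 by rewrite ltr_wpDl ?mulr_ge0.
have e2 : 0 < eps / 2 by rewrite divr_gt0.
have [a] := completion_approx hC c (divr_gt0 e2 M1).
rewrite ler_pdivlMr // => ha.
exists (commutator F (psi a) @` [set x | `|x| <= 1]).
  apply: totally_bounded_summable he _ _ _; last exact: basis_summable_commutator.
  exact: bounded_commutator (rep_bounded hpsi a).
move=> _ [x /= x1 <-]; exists (commutator F (psi a) x); first by exists x.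
have dE y : Psi c y - psi a y = Psi (c - iota a) y.
  by rewrite (repB rPsi) (extensionE hPsi).
have -> : commutator F (Psi c) x - commutator F (psi a) x =
    F (Psi (c - iota a) x) - Psi (c - iota a) (F x).
  by rewrite /commutator -!dE (linear_opB _ _ lF) !opprB addrACA [RHS]addrACA [- _ - _ in RHS]addrC.
have lec y : `|Psi (c - iota a) y| <= `|iota a - c| * `|y|.
  by rewrite distrC; exact: (extension_contractive hPsi).
apply: (@le_lt_trans _ _ (eps / 2)); last by rewrite ltr_pdivrMr // ltr_pMr // ltr1n.
apply: le_trans ha; rewrite (le_trans (ler_normD _ _)) // normrN.
have Fx : `|F x| <= M by rewrite (le_trans (hM x)) // ler_piMr.
apply: (@le_trans _ _ (M * `|iota a - c| + `|iota a - c| * M)).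
  apply: lerD; last by rewrite (le_trans (lec _)) // ler_wpM2l.
  rewrite (le_trans (hM _)) // ler_wpM2l // (le_trans (lec _)) // ler_piMr //.
by rewrite [M * _]mulrC -mulrDr ler_wpM2l // -[M + M]mulr2n -[M *+ 2]mulr_natr lerDl.
Qed.

End QuantumSphereModule.

Theorem mainTheorem6 (R : realType) (q : R) (n : nat) (hq : 1 < `|q|)
    (H : hilbertType R[i]) (e : int * {ffun 'I_n -> nat} -> H)
    (he : orthonormal_basis e)
    (psi : qsphere q n -> H -> H) (hpsi : star_representation psi)
    (hpsi1 : forall (k0 : int) (k : {ffun 'I_n -> nat}),
      psi (qsphere_gen q ord0) (e (k0, k)) =
      (q ^- (\sum_(l < n) k l)%N)%:C *: e (k0 + 1, k))
    (hpsiS : forall (j : 'I_n) (k0 : int) (k : {ffun 'I_n -> nat}),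
      psi (qsphere_gen q (lift ord0 j)) (e (k0, k)) =
      (Num.sqrt (1 - q ^- (2 * k j)%N)
         * q ^- (\sum_(l < n | (j < l)%N) k l)%N)%:C *: e (k0, decr j k))
    (F : H -> H) (hF : bounded_operator F)
    (hFe : forall (k0 : int) (k : {ffun 'I_n -> nat}),
      F (e (k0, k)) = chi R k0 *: e (k0, k))
    (C : cstarAlgType R[i]) (iota : qsphere q n -> C)
    (hC : universal_completion iota) :
  [/\ exists Psi : C -> H -> H, extends_to_completion iota psi Psi,
      forall Psi : C -> H -> H, extends_to_completion iota psi Psi ->
        forall c : C, compact_operator (commutator F (Psi c)),
      forall a : qsphere q n, trace_class (commutator F (psi a)) &
      odd_1summable_fredholm_module psi F].
Proof.
(* The index set is countable, so the space is separable and [psi] is one of the representations in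
   the supremum that defines the norm of iota a. *)
have psi_le a x : `|psi a x| <= `|iota a| * `|x|.
  rewrite (completion_norm hC); apply: rep_le_universal_norm => //.
  exact: orthonormal_basis_separable he.
have tr a : trace_class (commutator F (psi a)) by exact: trace_class_commutator hFe a.
split=> //; first exact: extension_to_completion.
  by move=> Psi hPsi c; exact: (compact_commutator hq he hpsi hpsi1 hpsiS hF hFe c hC hPsi).
split=> //; first exact: sign_selfadjoint hFe.
apply: (diagonal_square he hF (chi := fun p => chi R p.1)) => [[k0 k]|p].
  exact: hFe.
exact: chi_square.
Qed.
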